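(* Fix $p\in\{1,\dots,k\}$ with $d_p\ge2$ and distinct $q,r\in\{1,\dots,d_p\}$, and let $\Gamma_j=\mathrm{ins}_p\big((e_j^p)^{\otimes d_p}\otimes\tilde\Gamma_j\big)$, $j\neq p$, decompose in grouped $p$-slots. Let $A_{pq},A_{pr}$ be part of a solution of the extremality equation (E) and put $A(x)=A_{pq}(x)-A_{pr}(x)\in\mathbb R(x)$, which satisfies $$A\Big[(\mathcal S^2+\mathcal S')\langle\mu,\beta\rangle_x^2-2(m+1)\langle\mu,\beta\rangle_x\langle\mu,\beta\rangle'\mathcal S+(m+1)(m+2)(\langle\mu,\beta\rangle')^2\Big]+2A'\Big[\mathcal S\langle\mu,\beta\rangle_x^2-(m+1)\langle\mu,\beta\rangle_x\langle\mu,\beta\rangle'\Big]+A''\langle\mu,\beta\rangle_x^2=0.\qquad( * )$$ If $$\big\{\langle\mu,\beta\rangle_x^2,\ \langle\mu,\beta\rangle_x\langle\mu,\beta\rangle',\ (\langle\mu,\beta\rangle')^2\big\}$$ is a linearly independent set over the rational functions $\mathbb R(x)$, then $( * )$ has only the trivial solution $A=0$, i.e. $A_{pq}(x)=A_{pr}(x)$.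
   Context: Segre–Veronese factorization structure. Let $m=d_1+\cdots+d_k$, $m\ge2$, $d_j\ge1$, $W_1,\dots,W_k$ 2-dimensional real vector spaces, $V^*=\bigotimes_{i=1}^k(W_i^* )^{\otimes d_i}$ with slots labelled $(i,r)$; the slots $(p,1),\dots,(p,d_p)$ are the grouped $p$-slots. $\mathrm{ins}_j$ denotes the linear map reordering tensor factors so that the first $d_j$ factors are put in the grouped $j$-slots (used also when some other group of slots is absent). Let $\Gamma_j\in\bigotimes_{r\ne j}(W_r^* )^{\otimes d_r}$ be non-zero tensors such that $\mathfrak h:=\sum_{j}\mathrm{ins}_j(S^{d_j}W_j^*\otimes\langle\Gamma_j\rangle)\subset V^*$ has dimension $m+1$; $\varphi:\mathfrak h\hookrightarrow V^*$ is the inclusion. For $k=1$ (Veronese) $\mathfrak h=S^mW^*$, $\Gamma_1=1$. Notation. Identify $W_i,W_i^*$ with $\mathbb R^2$, $\langle(u,v),(a,b)\rangle=ua+vb$. With real variables $x_{ir}$: $\mathbf x=\bigotimes_{i,r}(1,x_{ir})$, $\hat{\mathbf x}_i=\bigotimes_{j\ne i}\bigotimes_s(1,x_{js})$, $\langle\mu,\alpha\rangle=\langle\mathbf x,\varphi(\alpha)\rangle$ for $\alpha\in\mathfrak h$, $\Delta_{ir}=\prod_{s\ne r}(x_{ir}-x_{is})$ ($=1$ if $d_i=1$). Fix $0\ne\beta\in\mathfrak h$. A solution of the extremality equation is a family of smooth non-vanishing functions $A_{ir}$ of one variable on open intervals $I_{ir}$ (with $\Delta_{ir},\langle\hat{\mathbf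 x}_i,\Gamma_i\rangle,\langle\mu,\beta\rangle$ non-vanishing on $\prod I_{ir}$) such that for some $\alpha\in\mathfrak h$ $$\text{(E)}\quad\sum_{i=1}^k\sum_{r=1}^{d_i}\frac{\langle\mu,\beta\rangle^{m+3}}{\Delta_{ir}\langle\hat{\mathbf x}_i,\Gamma_i\rangle\prod_{b=1}^k\langle\hat{\mathbf x}_b,\Gamma_b\rangle^{d_b}}\partial_{x_{ir}}^2\Big(\frac{A_{ir}(x_{ir})}{\langle\mu,\beta\rangle^{m+1}}\prod_{j=1}^k\langle\hat{\mathbf x}_j,\Gamma_j\rangle^{d_j}\Big)=\langle\mu,\alpha\rangle .$$ Any solution consists of (restrictions of) rational functions, and $A_{pq}(x),A_{pr}(x)$ are regarded as elements of $\mathbb R(x)$. For the fixed $p,q,r$: $\langle\mu,\beta\rangle_x=\langle\mu,\beta\rangle|_{x_{pq}=x_{pr}=x}$, $\langle\mu,\beta\rangle'=(\partial_{x_{pq}}\langle\mu,\beta\rangle)|_{x_{pq}=x_{pr}=x}=(\partial_{x_{pr}}\langle\mu,\beta\rangle)|_{x_{pq}=x_{pr}=x}$, and $\mathcal S(x)=\sum_{j\ne p}d_j\frac{\langle(0,1),e_j^p\rangle}{\langle(1,x),e_j^p\rangle}\in\mathbb R(x)$. Linear independence over $\mathbb R(x)$ is understood in the field of rational functions in $x$ and the remaining variables. *)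

(* Defs.v *)
From HB Require Import structures.
From mathcomp Require Import all_boot all_order all_algebra all_fingroup.
From mathcomp Require Import ring.
From mathcomp Require Import all_classical all_reals all_analysis.
(* Only the canonical structures of [mpoly] are imported: its notations clash
   with those of the analysis library. *)
From mathcomp Require mpoly.
Import (canonicals) mpoly.

Set Implicit Arguments.
Unset Strict Implicit.
Unset Printing Implicit Defensive.

Import Order.TTheory GRing.Theory Num.Theory.
Import numFieldNormedType.Exports.

Local Open Scope ring_scope.

(* A tensor in [\bigotimes_(s : T) (R^2)^*] is given by its coefficients on the
   standard basis: index 0 is the covector (1,0) and index 1 the covector (0,1). *)
Definition tensor (R : fieldType) (T : finType) : Type :=
  {ffun {ffun T -> 'I_2} -> R^o}.
HB.instance Definition _ (R : fieldType) (T : finType) :=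
  Vector.on (tensor R T).

(* The pairing <\bigotimes_s (1, x_s), t>, with values in a ring K that receives
   the scalars through [iota]. *)
Definition tpair (R : fieldType) (K : comNzRingType) (iota : R -> K)
    (T : finType) (x : T -> K) (t : tensor R T) : K :=
  \sum_(c : {ffun T -> 'I_2})
    iota (t c) * \prod_(s : T) (if c s == ord0 then 1 else x s).

Definition tpow (R : fieldType) (n : nat) (e : 'rV[R]_2) : tensor R 'I_n :=
  [ffun c : {ffun 'I_n -> 'I_2} => \prod_(r < n) e ord0 (c r)].

Definition tperm_act (R : fieldType) (n : nat) (s : 'S_n) (t : tensor R 'I_n) :
  tensor R 'I_n := [ffun c : {ffun 'I_n -> 'I_2} => t [ffun r => c (s r)]].

Lemma tperm_act_is_linear (R : fieldType) (n : nat) (s : 'S_n) :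
  linear (@tperm_act R n s).
Proof. by move=> a t u; apply/ffunP => c; rewrite !ffunE. Qed.

HB.instance Definition _ (R : fieldType) (n : nat) (s : 'S_n) :=
  GRing.isLinear.Build R (tensor R 'I_n) (tensor R 'I_n) _ _
    (@tperm_act_is_linear R n s).

Definition sym (R : fieldType) (n : nat) : {vspace tensor R 'I_n} :=
  (\bigcap_(s : 'S_n) fixedSpace (linfun (@tperm_act R n s)))%VS.

Lemma symP (R : fieldType) (n : nat) (t : tensor R 'I_n) :
  reflect (forall (s : 'S_n) (c : {ffun 'I_n -> 'I_2}), t [ffun r => c (s r)] = t c) (t \in sym R n).
Proof.
rewrite /sym memvE.
apply: (iffP subv_bigcapP) => H s.
  move=> c; have := H s isT; rewrite -memvE => /fixedSpaceP; rewrite lfunE /= => E.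
  by rewrite -[in RHS]E ffunE.
move=> _; rewrite -memvE; apply/fixedSpaceP; rewrite lfunE /=.
by apply/ffunP=> c; rewrite ffunE H.
Qed.

Definition slot (k : nat) (d : 'I_k -> nat) : finType := {i : 'I_k & 'I_(d i)}.

Definition mkslot (k : nat) (d : 'I_k -> nat) (i : 'I_k) (r : 'I_(d i)) :
  slot d := Tagged (fun i => 'I_(d i)) r.

(* The slots of the groups in B. *)
Definition slots (k : nat) (d : 'I_k -> nat) (B : pred 'I_k) : finType :=
  {s : slot d | B (tag s)}.

Definition off (k : nat) (B : pred 'I_k) (j : 'I_k) : pred 'I_k :=
  fun i => B i && (i != j).

Definition slots_widen (k : nat) (d : 'I_k -> nat) (B : pred 'I_k) (j : 'I_k)
    (s : slots d (off B j)) : slots d B :=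
  exist _ (val s) (proj1 (andP (valP s))).

(* ins_j (u \otimes G), where u fills the j-slots and G the other ones. *)
Definition ins (R : fieldType) (k : nat) (d : 'I_k -> nat) (B : pred 'I_k)
    (j : 'I_k) (jB : B j) (G : tensor R (slots d (off B j)))
    (u : tensor R 'I_(d j)) : tensor R (slots d B) :=
  [ffun c : {ffun slots d B -> 'I_2} =>
     u [ffun r => c (exist _ (mkslot r) jB)] * G [ffun s => c (slots_widen s)]].

Lemma ins_is_linear (R : fieldType) (k : nat) (d : 'I_k -> nat) (B : pred 'I_k)
    (j : 'I_k) (jB : B j) (G : tensor R (slots d (off B j))) :
  linear (ins jB G).
Proof.
by move=> a t u; apply/ffunP => c; rewrite !ffunE mulrDl scalerAl.
Qed.

HB.instance Definition _ (R : fieldType) (k : nat) (d : 'I_k -> nat)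
    (B : pred 'I_k) (j : 'I_k) (jB : B j) (G : tensor R (slots d (off B j))) :=
  GRing.isLinear.Build R (tensor R 'I_(d j)) (tensor R (slots d B)) _ _
    (ins_is_linear jB G).

Definition Vdual (R : fieldType) (k : nat) (d : 'I_k -> nat) : Type :=
  tensor R (slots d predT).
HB.instance Definition _ (R : fieldType) (k : nat) (d : 'I_k -> nat) :=
  Vector.on (Vdual R d).

Definition hspace (R : fieldType) (k : nat) (d : 'I_k -> nat)
    (Gam : forall j, tensor R (slots d (off predT j))) : {vspace Vdual R d} :=
  (\sum_(j < k)
     (linfun (@ins R k d predT j isT (Gam j)) @: sym R (d j)))%VS.

Lemma hspaceP (R : fieldType) (k : nat) (d : 'I_k -> nat)
    (Gam : forall j, tensor R (slots d (off predT j))) (al : Vdual R d) :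
  al \in hspace Gam <->
  exists2 u : forall j, tensor R 'I_(d j), forall j, u j \in sym R (d j) &
    al = \sum_j @ins R k d predT j isT (Gam j) (u j).
Proof.
split.
 move/memv_sumP => [v Hv ->].
 have H j : exists u, u \in sym R (d j) /\ v j = @ins R k d predT j isT (Gam j) u.
   by have /memv_imgP[u Hu ->] := Hv j isT; exists u; split=>//; rewrite lfunE.
 exists (fun j => sval (cid (H j))); first by move=> j; case: cid => ? /= [].
 by apply: eq_bigr => j _; case: cid => ? /= [].
case=> u Hu ->; apply: memv_sumr => j _; apply/memv_imgP.
exists (u j); [exact: Hu | by rewrite lfunE].
Qed.

Section Equation.

Variables (R : realType) (k : nat) (d : 'I_k -> nat).
Variable Gam : forall j, tensor R (slots d (off predT j)).

(* m = d_1 + ... + d_k *)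
Definition slots_dim : nat := \sum_(i < k) d i.

(* <x, phi(al)> *)
Definition mu (x : slot d -> R) (al : Vdual R d) : R :=
  tpair id (x \o val) al.

(* <\hat x_j, Gam_j> *)
Definition muhat (x : slot d -> R) (j : 'I_k) : R :=
  tpair id (x \o val) (Gam j).

Definition Delta (x : slot d -> R) (i : 'I_k) (r : 'I_(d i)) : R :=
  \prod_(s < d i | s != r) (x (mkslot r) - x (mkslot s)).

Definition partial2 (s : slot d) (F : (slot d -> R) -> R) (x : slot d -> R) : R :=
  derive1n 2 (fun t => F [eta x with s |-> t]) (x s).

Definition smooth_on (I : set R) (f : R -> R) : Prop :=
  forall (n : nat) (t : R), I t -> derivable (derive1n n f) t 1.

Definition extremality_lhs (be : Vdual R d) (A : slot d -> R -> R)
    (x : slot d -> R) : R :=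
  \sum_(i < k) \sum_(r < d i)
    mu x be ^+ (slots_dim + 3) /
      (Delta x r * muhat x i * \prod_(b < k) muhat x b ^+ d b) *
    partial2 (mkslot r)
      (fun y => A (mkslot r) (y (mkslot r)) / mu y be ^+ (slots_dim + 1) *
                \prod_(j < k) muhat y j ^+ d j) x.

Definition extremality_solution (be : Vdual R d) (I : slot d -> set R)
    (A : slot d -> R -> R) : Prop :=
  [/\ forall s, [/\ open (I s), is_interval (I s) & exists t, I s t],
      forall s, smooth_on (I s) (A s) /\ forall t, I s t -> A s t <> 0,
      forall x, (forall s, I s (x s)) ->
        [/\ forall i (r : 'I_(d i)), Delta x r <> 0,
            forall i, muhat x i <> 0
          & mu x be <> 0]
    & exists2 al : Vdual R d, al \in hspace Gam &
      forall x, (forall s, I s (x s)) -> extremality_lhs be A x = mu x al].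

End Equation.

Definition ratfun (R : realType) : fieldType := {fraction {poly R}}.

Definition Rx_X (R : realType) : ratfun R := tofrac 'X.

Definition Rx_C (R : realType) (c : R) : ratfun R := tofrac c%:P.

(* The derivation d/dx of R(x), through the representative fraction chosen by
   the quotient; see [Rx_derivE] for independence of the representative. *)
Definition Rx_deriv (R : realType) (f : ratfun R) : ratfun R :=
  let n := (fraction.frac (generic_quotient.repr f)).1 in let q := (fraction.frac (generic_quotient.repr f)).2 in
  tofrac (n^`() * q - n * q^`()) / tofrac (q ^+ 2).

Lemma ratfun_repr (R : realType) (f : ratfun R) :
  f = tofrac (fraction.frac (generic_quotient.repr f)).1 /
      tofrac (fraction.frac (generic_quotient.repr f)).2.
Proof.
rewrite -[LHS]generic_quotient.reprK.
unlock FracField.tofrac; rewrite -[X in _ = _ * X]FracField.pi_inv.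
rewrite -[RHS]FracField.pi_mul.
rewrite /FracField.mulf /FracField.invf !numden_Ratio ?oner_neq0 //.
by rewrite mulr1 mul1r FracField.Ratio_numden.
all: exact: denom_ratioP.
Qed.

Lemma Rx_derivE (R : realType) (n q : {poly R}) : q != 0 ->
  Rx_deriv (tofrac n / tofrac q : ratfun R) =
  tofrac (n^`() * q - n * q^`()) / tofrac (q ^+ 2).
Proof.
move=> q0; rewrite /Rx_deriv; move: (ratfun_repr (tofrac n / tofrac q)).
move: (denom_ratioP (generic_quotient.repr (tofrac n / tofrac q))).
case: (fraction.frac _) => n1 q1 /= q10.
have F0 (a : {poly R}) : a != 0 -> tofrac a != 0 by rewrite tofrac_eq0.
move/eqP; rewrite eqr_div ?F0 // -!tofracM tofrac_eq => /eqP E.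
have := congr1 (@deriv R) E; rewrite !derivM => E'.
apply/eqP; rewrite eqr_div ?F0 ?expf_neq0 // -!tofracM; apply/eqP; congr tofrac.
have D1 : n1^`() * q = n^`() * q1 + n * q1^`() - n1 * q^`() by rewrite E' addrK.
transitivity ((n1^`() * q) * q1 * q - (n1 * q) * q1^`() * q); first by ring.
rewrite D1 -E.
transitivity (n^`() * q * q1 ^+ 2 - (n1 * q) * q^`() * q1); first by ring.
by rewrite -E; ring.
Qed.

(* The smooth function f is the restriction to I of the rational function a. *)
Definition restricts (R : realType) (a : ratfun R) (I : set R) (f : R -> R) :
    Prop :=
  exists n q : {poly R}, a = tofrac n / tofrac q /\
    forall t, I t -> q.[t] <> 0 /\ f t = n.[t] / q.[t].

Section Diagonal.

Variables (R : realType) (k : nat) (d : 'I_k -> nat).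
Variables (p : 'I_k) (q r : 'I_(d p)).

(* The slots other than (p,q) and (p,r): the "remaining variables". *)
Definition rest : finType :=
  {s : slot d | (s != mkslot q) && (s != mkslot r)}.

(* Rational functions in x and the remaining variables, presented as the field
   of fractions of R(x)[x_s, s in rest]. *)
Definition diagfield : fieldType :=
  {fraction (mpoly.mpoly #|rest| (ratfun R))}.

Definition diag_iota (a : ratfun R) : diagfield :=
  tofrac (mpoly.mpolyC #|rest| a).

(* The substitution x_pq = x_pr = x. *)
Definition diag_var (s : slot d) : diagfield :=
  if insub s is Some u
  then tofrac (mpoly.mpolyX (ratfun R) (mpoly.mnm1 (enum_rank (u : rest))))
  else diag_iota (Rx_X R).

Definition diag_subst (P : mpoly.mpoly #|slot d| R) : diagfield :=
  mpoly.mmap (fun c : R => diag_iota (Rx_C c)) (diag_var \o enum_val) P.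

(* <x, phi(be)> as a polynomial in all the variables x_s. *)
Definition mu_poly (be : Vdual R d) : mpoly.mpoly #|slot d| R :=
  tpair (fun c : R => mpoly.mpolyC #|slot d| c)
    (fun s => mpoly.mpolyX R (mpoly.mnm1 (enum_rank (val s)))) be.

Definition mu_diag (be : Vdual R d) : diagfield := diag_subst (mu_poly be).

(* By symmetry of be in the p-slots, the derivative along x_pr gives the same. *)
Definition mu_diag' (be : Vdual R d) : diagfield :=
  diag_subst (mpoly.mderiv (enum_rank (mkslot q)) (mu_poly be)).

Definition Ssum (e : 'I_k -> 'rV[R]_2) : ratfun R :=
  \sum_(j < k | j != p)
    (d j)%:R * (Rx_C (e j ord0 1) /
                (Rx_C (e j ord0 0) + Rx_X R * Rx_C (e j ord0 1))).

Definition star (e : 'I_k -> 'rV[R]_2) (be : Vdual R d) (A : ratfun R) : Prop :=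
  let m1 : diagfield := (slots_dim d + 1)%:R in
  let m2 : diagfield := (slots_dim d + 2)%:R in
  let b := mu_diag be in
  let b' := mu_diag' be in
  let S := diag_iota (Ssum e) in
  let S' := diag_iota (Rx_deriv (Ssum e)) in
  diag_iota A *
    ((S ^+ 2 + S') * b ^+ 2 - 2 * m1 * b * b' * S + m1 * m2 * b' ^+ 2) +
  2 * diag_iota (Rx_deriv A) * (S * b ^+ 2 - m1 * b * b') +
  diag_iota (Rx_deriv (Rx_deriv A)) * b ^+ 2 = 0.

Definition diag_independent (be : Vdual R d) : Prop :=
  let b := mu_diag be in
  let b' := mu_diag' be in
  forall c0 c1 c2 : ratfun R,
    diag_iota c0 * b ^+ 2 + diag_iota c1 * (b * b') + diag_iota c2 * b' ^+ 2 = 0 ->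
    [/\ c0 = 0, c1 = 0 & c2 = 0].

End Diagonal.

(* Main.v *)
(* Write b = <mu,be>, P = \prod_j <\hat x_j, Gam_j>^(d_j), and b', P', P'' for derivatives along
   a slot.  Multiplied out, the (i,r)-summand of (E) is T_ir / (Delta_ir <\hat x_i, Gam_i> P) with
   T_ir = P (b^2 A'' + ...) polynomial in the variables apart from A_ir, A_ir', A_ir''.  If i = p,
   then P' / P and P'' / P depend on x_pr only and T_pr / P is a quadratic form in (b, b') with
   coefficients K0, K1, K2 depending on x_pr only, where K2 = (m+1)(m+2) A_pr up to a factor.
   - Fix all variables but x_pq.  Then (E) expresses T_pq as a rational function of x_pq in
     I_pq, regular at x_pq = x_pr with value T_pr there, since only the summands pq and pr are
     singular on the diagonal and their residues are opposite.
   - Hence, by continuation in x_pq alone, T_pq = T_pr on the diagonal, which is ( * ).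
   - b is affine in x_pq, b = w + x_pq v.  If w^2, w v, v^2 are linearly independent, finitely many
     choices of the other variables solve for K2, so A_pq is rational.
   - Under the independence hypothesis the coefficient (m+1)(m+2) A of b'^2 in ( * ) vanishes. *)

Require Import Defs.
From HB Require Import structures.
From mathcomp Require Import all_boot all_order all_algebra all_fingroup.
From mathcomp Require Import ring.
From mathcomp Require Import all_classical all_reals all_analysis.
From mathcomp Require mpoly.
Import (canonicals) mpoly.
Import mpoly(meval, mderiv, mmap, mpolyC, mpolyX, mnm1, mcoeff).

Set Implicit Arguments.
Unset Strict Implicit.
Unset Printing Implicit Defensive.

Import Order.TTheory GRing.Theory Num.Theory.
Import numFieldNormedType.Exports.

Local Open Scope ring_scope.

(** * Polynomials in the slot variables and their vanishing on products of intervals *)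

Lemma mpoly_ring_ind (n : nat) (R : comNzRingType) (Q : mpoly.mpoly n R -> Prop) :
  (forall c, Q (mpolyC n c)) -> (forall i, Q (mpolyX R (mnm1 i))) ->
  (forall f g, Q f -> Q g -> Q (f + g)) -> (forall f g, Q f -> Q g -> Q (f * g)) ->
  forall f, Q f.
Proof.
move=> QC QX QD QM f; rewrite (mpoly.mpolyE f).
apply: (big_ind Q) => //; first by rewrite -mpoly.mpolyC0.
move=> m _; rewrite -mpoly.mul_mpolyC; apply: (QM) => //.
rewrite mpoly.mpolyXE_id; apply: (big_ind Q); [by rewrite -mpoly.mpolyC1|exact: QM|].
move=> i _; elim: (mpoly.fun_of_multinom m i) => [|l IH]; first by rewrite expr0 -mpoly.mpolyC1.
by rewrite exprS; apply: QM.
Qed.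

(** The property of an interval that turns vanishing at points into vanishing of polynomials. *)
Definition unisolvent (R : realType) (J : set R) : Prop :=
  forall g : {poly R}, (forall t, J t -> g.[t] = 0) -> g = 0.

Lemma unisolvent_open (R : realType) (J : set R) : open J -> (exists t, J t) -> unisolvent J.
Proof.
move=> oJ [a Ja] g g0; apply/eqP; apply: contraT => gn0.
have [e /= e0 He] : nbhs a J by exact: open_nbhs_nbhs.
(* Distinct points of the ball, one more than [g] can have roots; [i.+2] keeps them strictly
   inside. *)
pose s := [seq a + e / (i.+2)%:R | i <- iota 0 (size g)].
have us : uniq s.
  rewrite map_inj_uniq ?iota_uniq // => i j /addrI/(mulfI (lt0r_neq0 e0))/invr_inj/eqP.
  by rewrite eqr_nat => /eqP [].
have := max_poly_roots gn0 _ us; rewrite size_map size_iota ltnn; apply.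
apply/allP => _ /mapP[i _ ->]; apply/eqP/g0/He => /=.
rewrite distrC.
rewrite addrC addKr ger0_norm ?divr_ge0 ?ler0n ?(ltW e0) //.
by rewrite ltr_pdivrMr ?ltr0n // ltr_pMr // ltr1n.
Qed.

Section SlotPolynomials.

Variables (R : realType) (T : finType).
Implicit Types (F G : mpoly.mpoly #|T| R) (x : T -> R) (s : T).

Definition ev x F : R := meval (x \o enum_val) F.
HB.instance Definition _ x := GRing.RMorphism.copy (ev x) (meval (x \o enum_val)).

Definition var s : mpoly.mpoly #|T| R := mpolyX R (mnm1 (enum_rank s)).

Lemma evC x c : ev x (mpolyC #|T| c) = c. Proof. exact: mpoly.mevalC. Qed.

Lemma ev_var x s : ev x (var s) = x s.
Proof. by rewrite /ev mpoly.mevalXU /= enum_rankK. Qed.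

Lemma eq_ev x y F : x =1 y -> ev x F = ev y F.
Proof. by move=> xy; apply: mpoly.meval_eq => i /=; rewrite xy. Qed.

(** All variables but that of [s] are frozen at [x], so that [mderiv] becomes the derivative of a
    univariate polynomial, which also serves for the analytic derivatives in (E). *)
Definition restr s x F : {poly R} :=
  mmap polyC (fun i => if enum_val i == s then 'X else (x (enum_val i))%:P) F.
HB.instance Definition _ s x := GRing.RMorphism.copy (restr s x)
  (mmap polyC (fun i : 'I_#|T| => if enum_val i == s then 'X else (x (enum_val i))%:P)).

Lemma restrC s x c : restr s x (mpolyC #|T| c) = c%:P.
Proof. exact: mpoly.mmapC. Qed.

Lemma restrX s x i : restr s x (mpolyX R (mnm1 i)) =
  if enum_val i == s then 'X else (x (enum_val i))%:P.
Proof. by rewrite /restr mpoly.mmapX mpoly.mmap1U. Qed.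

Lemma horner_restr s x F t : (restr s x F).[t] = ev [eta x with s |-> t] F.
Proof.
elim/mpoly_ring_ind: F => [c|i|f g Hf Hg|f g Hf Hg].
- by rewrite restrC evC hornerC.
- by rewrite restrX /ev mpoly.mevalXU /=; case: ifP; rewrite ?hornerX ?hornerC.
- by rewrite !rmorphD hornerD Hf Hg.
- by rewrite !rmorphM hornerM Hf Hg.
Qed.

Lemma ev_restr s x F : ev x F = (restr s x F).[x s].
Proof. by rewrite horner_restr; apply: eq_ev => u /=; case: eqP => [->|]. Qed.

Lemma deriv_restr s x F : (restr s x F)^`() = restr s x (mderiv (enum_rank s) F).
Proof.
elim/mpoly_ring_ind: F => [c|i|f g Hf Hg|f g Hf Hg].
- by rewrite restrC mpoly.mderivC derivC rmorph0.
- have -> : mderiv (enum_rank s) (mpolyX R (mnm1 i)) = mpolyC #|T| (enum_val i == s)%:R.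
    rewrite mpoly.mderivX mpoly.mnm1E -[i]enum_valK (inj_eq enum_rank_inj) enum_rankK.
    case: eqP => [->|_]; last by rewrite scale0r mpoly.mpolyC0.
    rewrite /= scale1r mpoly.mpolyC1 -mpoly.mpolyX0; congr mpolyX.
    by apply/mpoly.mnmP => l; rewrite mpoly.mnmBE mpoly.mnm0E subnn.
  by rewrite restrX restrC; case: eqP => _; rewrite ?derivX ?derivC.
- by rewrite mpoly.mderivD !rmorphD derivD Hf Hg.
- by rewrite mpoly.mderivM !rmorphD !rmorphM derivM Hf Hg.
Qed.

(** The constant coefficient is the value at 0. Any other one is, up to a positive integer factor, a
    coefficient of lower degree of a partial derivative, which again vanishes everywhere; hence the
    induction on the degree. *)
Lemma ev_eq0 F : (forall x, ev x F = 0) -> F = 0.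
Proof.
move=> F0; apply/mpoly.mpolyP => m; rewrite mpoly.mcoeff0.
have [l] := ubnP (mpoly.mdeg m).
elim: l m F F0 => // l IH m F F0 ml.
have ev0 G : ev (fun=> 0) G = mcoeff (@mpoly.mnm0 #|T|) G.
  elim/mpoly_ring_ind: G => [c|i|f g Hf Hg|f g Hf Hg].
  - by rewrite evC mpoly.mcoeffC eqxx mulr1.
  - by rewrite /ev mpoly.mevalXU mpoly.mcoeffX mpoly.mnm1_eq0.
  - by rewrite !rmorphD /= Hf Hg.
  - by rewrite !rmorphM /= Hf Hg.
have [->|m0] := eqVneq m (@mpoly.mnm0 #|T|); first by rewrite -ev0 F0.
have [i mi] : exists i, mpoly.fun_of_multinom m i != 0%N.
  apply/existsP; rewrite -negb_forall; apply: contra m0 => /forallP H.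
  by apply/eqP/mpoly.mnmP => i; rewrite mpoly.mnm0E; apply/eqP/H.
have {}F0 x : ev x (mderiv i F) = 0.
  rewrite -[i]enum_valK (ev_restr (enum_val i)) -deriv_restr.
  suff -> : restr (enum_val i) x F = 0 by rewrite derivC horner0.
  apply: (@unisolvent_open R setT); [exact: openT|by exists 0|] => t _.
  by rewrite horner_restr.
have mE : m = mpoly.mnm_add (mpoly.mnm_sub m (mnm1 i)) (mnm1 i).
  by rewrite mpoly.submK // mpoly.lep1mP.
have := IH (mpoly.mnm_sub m (mnm1 i)) _ F0.
rewrite mpoly.mcoeff_mderiv -mE => /(_ _)/eqP; rewrite mulrn_eq0 => /(_ _)/eqP; apply.
by move: ml; rewrite {1}mE mpoly.mdegD mpoly.mdeg1 addn1.
Qed.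

Lemma ev_box_eq0 (J : T -> set R) F : (forall s, unisolvent (J s)) ->
  (forall x, (forall s, J s (x s)) -> ev x F = 0) -> F = 0.
Proof.
move=> HJ F0; apply: ev_eq0 => x.
(* Slots in the list may take any real value; each step frees one more of them by unisolvence. *)
have: forall s, s \notin enum T -> J s (x s) by move=> s; rewrite mem_enum.
elim: (enum T) x => [|s l IH] x Hx; first by apply: F0 => s; apply: Hx.
rewrite (ev_restr s) (HJ s (restr s x F)) ?horner0 // => t Jt.
rewrite horner_restr; apply: IH => u ul /=; case: eqP => [->//|/eqP us].
by apply: Hx; rewrite inE negb_or us.
Qed.

End SlotPolynomials.

(** * Pairings with decomposable tensors *)

Section Tensors.

Variables (R : fieldType).

Lemma eq_tpair (K : comNzRingType) (iota iota' : R -> K) (T : finType) (x y : T -> K) t :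
  iota =1 iota' -> x =1 y -> tpair iota x t = tpair iota' y t.
Proof.
move=> ii xy; apply: eq_bigr => c _; rewrite ii; congr (_ * _).
by apply: eq_bigr => s _; rewrite xy.
Qed.

Lemma rmorph_tpair (K K' : comNzRingType) (f : {rmorphism K -> K'}) (iota : R -> K)
    (T : finType) (x : T -> K) (t : tensor R T) :
  f (tpair iota x t) = tpair (f \o iota) (f \o x) t.
Proof.
rewrite rmorph_sum; apply: eq_bigr => c _; rewrite rmorphM rmorph_prod; congr (_ * _).
by apply: eq_bigr => s _; rewrite [LHS]fun_if rmorph1.
Qed.

(** Each monomial contains [x s] to the power at most one; 0 and 1 are the interpolation nodes. *)
Lemma tpair_affine (K : comNzRingType) (iota : R -> K) (T : finType) (x : T -> K)
    (t : tensor R T) (s : T) :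
  tpair iota x t = tpair iota [eta x with s |-> 0] t +
    x s * (tpair iota [eta x with s |-> 1] t - tpair iota [eta x with s |-> 0] t).
Proof.
rewrite /tpair -sumrB mulr_sumr -big_split; apply: eq_bigr => c _ /=.
have E y : \prod_u (if c u == ord0 then 1 else [eta x with s |-> y] u) =
    (if c s == ord0 then 1 else y) * \prod_(u | u != s) (if c u == ord0 then 1 else x u).
  rewrite (bigD1 s) //= eqxx; congr (_ * _).
  by apply: eq_bigr => u /negbTE ->.
rewrite !E [X in _ * X](bigD1 s) //=; case: eqP => _; ring.
Qed.

Lemma tpair_tpow (n : nat) (e : 'rV[R]_2) (x : 'I_n -> R) :
  tpair id x (tpow n e) = \prod_(r < n) (e ord0 0 + x r * e ord0 1).
Proof.
have -> : \prod_(r < n) (e ord0 0 + x r * e ord0 1) =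
    \prod_(r < n) \sum_(b : 'I_2) e ord0 b * (if b == ord0 then 1 else x r).
  apply: eq_bigr => r _; rewrite big_ord_recl big_ord1 /= mulr1 mulrC; congr (_ + _ * _).
  by congr (e _ _); apply: val_inj.
rewrite bigA_distr_bigA; apply: eq_bigr => c _; rewrite ffunE big_split /=.
by [].
Qed.

(** An assignment on [T] is a pair of assignments on [T1] and [T2] ([sp] splits, [jn] joins), so the
    sum defining the pairing factors. *)
Lemma tpair_sumtype (K : comNzRingType) (iota : {rmorphism R -> K}) (T T1 T2 : finType)
    (h : T1 + T2 -> T) (t : tensor R T) (t1 : tensor R T1) (t2 : tensor R T2) (x : T -> K) :
  bijective h ->
  (forall c, t c = t1 [ffun r => c (h (inl r))] * t2 [ffun r => c (h (inr r))]) ->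
  tpair iota x t = tpair iota (x \o h \o inl) t1 * tpair iota (x \o h \o inr) t2.
Proof.
case=> g gK hK tE; rewrite /tpair big_distrlr pair_big /=.
pose sp (c : {ffun T -> 'I_2}) :=
  ([ffun r => c (h (inl r))] : {ffun T1 -> 'I_2}, [ffun r => c (h (inr r))] : {ffun T2 -> 'I_2}).
pose jn (c : {ffun T1 -> 'I_2} * {ffun T2 -> 'I_2}) : {ffun T -> 'I_2} :=
  [ffun s => match g s with inl r => c.1 r | inr r => c.2 r end].
rewrite (reindex sp); last first.
  exists jn => [c _|[c1 c2] _].
    by apply/ffunP => s; rewrite ffunE -[in RHS](hK s); case: (g s) => r /=; rewrite ffunE.
  by congr (_, _); apply/ffunP => s; rewrite !ffunE gK.
apply: eq_bigr => c _ /=; rewrite tE rmorphM mulrACA; congr (_ * _).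
rewrite (reindex h) /=; last by exists g => s _.
by rewrite big_sumType; congr (_ * _); apply: eq_bigr => r _; rewrite /= ffunE.
Qed.

(** The [j]-slots and the slots outside group [j] partition the slots of [B]; [h] is the
    bijection. *)
Lemma tpair_ins (K : comNzRingType) (iota : {rmorphism R -> K}) (k : nat) (d : 'I_k -> nat)
    (B : pred 'I_k) (j : 'I_k) (jB : B j) (G : tensor R (slots d (off B j)))
    (u : tensor R 'I_(d j)) (x : slots d B -> K) :
  tpair iota x (ins jB G u) =
  tpair iota (fun r => x (exist _ (mkslot r) jB)) u * tpair iota (fun s => x (slots_widen s)) G.
Proof.
pose h (a : 'I_(d j) + slots d (off B j)) : slots d B :=
  match a with inl r => exist _ (mkslot r) jB | inr s => slots_widen s end.
have hbij : bijective h.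
  apply: inj_card_bij.
    move=> [r|s] [r'|s'] /(congr1 val) /= H.
    - by congr inl; apply: eq_from_Tagged H.
    - by case/andP: (valP s') => _; rewrite -[val s']H eqxx.
    - by case/andP: (valP s) => _; rewrite [val s]H eqxx.
    - by congr inr; apply: val_inj.
  apply: (@leq_trans #|codom h|); last by rewrite leq_image_card.
  apply/subset_leq_card/fintype.subsetP => -[[i r] Bi] _; apply/codomP.
  have [ij|ij] := eqVneq i j; first by subst i; exists (inl r); apply: val_inj.
  have Oi : off B j (tag (mkslot r)) by apply/andP.
  by exists (inr (exist (fun s : slot d => off B j (tag s)) (mkslot r) Oi)); apply: val_inj.
by rewrite (@tpair_sumtype _ _ _ _ _ h _ u G) // => c; rewrite ffunE.
Qed.

End Tensors.

(** * Derivatives of quotients by powers of a polynomial *)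

Lemma is_derive_div_poly_exp (R : realType) (f : R -> R) (df t : R) (b : {poly R}) (n : nat) :
  is_derive t 1 f df -> b.[t] != 0 ->
  is_derive t 1 (fun u => f u / b.[u] ^+ n)
    ((df * b.[t] - n%:R * b^`().[t] * f t) / b.[t] ^+ n.+1).
Proof.
move=> Df b0.
have Db : is_derive t 1 (horner (b ^+ n)) (b ^+ n)^`().[t] by exact: is_derive_poly.
have bn0 : (b ^+ n).[t] != 0 by rewrite horner_exp expf_neq0.
have := is_deriveM Df (is_deriveV bn0 Db).
have -> : (f * (fun u => (b ^+ n).[u]^-1)) = (fun u => f u / b.[u] ^+ n).
  by apply/funext => u; rewrite /= -horner_exp.
move=> D; apply: (is_derive_eq D).
rewrite deriv_exp hornerMn hornerM !horner_exp /GRing.scale /=.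
(* The derivative of [b ^+ n] involves [n.-1], so [n = 0] is treated apart. *)
case: n {Db bn0 D} => [|n]; first by rewrite !expr0 mulr0n invr1; field.
have bn : b.[t] ^+ n != 0 by rewrite expf_neq0.
rewrite -pred_Sn -mulr_natl !exprS; move: (b.[t] ^+ n) bn => c c0; field.
by rewrite b0 c0.
Qed.

Lemma is_derive_on_derive1 (R : realType) (J : set R) (f df : R -> R) :
  (forall t, J t -> is_derive t 1 f (df t)) -> forall t, J t -> derive1 f t = df t.
Proof. by move=> D t Jt; rewrite derive1E; exact: (@derive_val _ _ _ _ _ _ _ (D t Jt)). Qed.

Lemma eq_on_derive1 (R : realType) (J : set R) (f g : R -> R) : open J ->
  (forall t, J t -> f t = g t) -> forall t, J t -> derive1 f t = derive1 g t.
Proof.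
move=> oJ fg t Jt; rewrite !derive1E; apply: near_eq_derive.
by near=> u; apply: fg; near: u; exact: open_nbhs_nbhs.
Unshelve. all: by end_near. Qed.

(** The quotient rule twice, for [b] with zero second derivative, as <mu,be> is affine in each slot
    variable. The products b^2, b b', b'^2 of [star] arise here. *)
Lemma derive1n2_div_poly_exp (R : realType) (J : set R) (f : R -> R) (b g : {poly R})
    (n : nat) (t : R) : open J ->
  (forall u, J u -> derivable f u 1 /\ derivable (derive1 f) u 1) ->
  (forall u, J u -> b.[u] != 0) -> b^`()^`() = 0 -> J t ->
  derive1n 2 (fun u => f u / b.[u] ^+ n * g.[u]) t =
  (derive1n 2 f t * (b.[t] ^+ 2 * g.[t]) +
   2 * derive1 f t * (b.[t] ^+ 2 * g^`().[t] - n%:R * (b.[t] * b^`().[t] * g.[t])) +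
   f t * (b.[t] ^+ 2 * g^`()^`().[t] - 2 * n%:R * (b.[t] * b^`().[t] * g^`().[t])
          + n%:R * n.+1%:R * (b^`().[t] ^+ 2 * g.[t]))) / b.[t] ^+ n.+2.
Proof.
move=> oJ df b0 b2 Jt.
have D1 u : J u -> is_derive u 1 f (derive1 f u).
  by move=> /df[H _]; rewrite derive1E; apply: DeriveDef.
have D2 u : J u -> is_derive u 1 (derive1 f) (derive1n 2 f u).
  by move=> /df[_ H]; rewrite /= derive1E; apply: DeriveDef.
have DM (h dh : R -> R) (c : {poly R}) (u : R) : is_derive u 1 h (dh u) ->
    is_derive u 1 (fun u => h u * c.[u]) (dh u * c.[u] + h u * c^`().[u]).
  move=> Dh; apply: (is_derive_eq (is_deriveM Dh (is_derive_poly c u))).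
  by rewrite /GRing.scale /= addrC mulrC.
(* Numerator of the first derivative over [b ^+ n.+1]. *)
pose N u := derive1 f u * (g * b).[u] + f u * (g^`() * b - n%:R *: (b^`() * g)).[u].
have E1 u : J u -> derive1 (fun u => f u / b.[u] ^+ n * g.[u]) u = N u / b.[u] ^+ n.+1.
  move: u; apply: is_derive_on_derive1 => u Ju.
  have -> : (fun u => f u / b.[u] ^+ n * g.[u]) = (fun u => (f u * g.[u]) / b.[u] ^+ n).
    by apply/funext => v; rewrite mulrAC.
  apply: (is_derive_eq (is_derive_div_poly_exp n (DM _ _ g u (D1 u Ju)) (b0 u Ju))).
  by congr (_ / _); rewrite /N !(hornerM, hornerD, hornerN, hornerZ); ring.
rewrite (_ : derive1n 2 _ = derive1 (derive1 (fun u => f u / b.[u] ^+ n * g.[u]))) //.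
rewrite (eq_on_derive1 oJ E1 Jt); move: t Jt; apply: is_derive_on_derive1 => u Ju.
have DN := is_deriveD (DM _ _ (g * b) u (D2 u Ju))
  (DM _ _ (g^`() * b - n%:R *: (b^`() * g)) u (D1 u Ju)).
apply: (is_derive_eq (is_derive_div_poly_exp n.+1 DN (b0 u Ju))).
congr (_ / _); rewrite /N !(derivM, derivB, derivZ) b2 mul0r add0r.
rewrite addrfctE !(hornerM, hornerD, hornerN, hornerZ) -(addn1 n) natrD /=.
rewrite ?natrD; ring.
Qed.

(** * The field R(x) and its derivation *)

Section FractionIdentities.

Variables (A : comNzRingType) (K : fieldType) (F : {rmorphism A -> K}).

Lemma rmorph_subf (n1 n2 q1 q2 : A) : F q1 != 0 -> F q2 != 0 ->
  F n1 / F q1 - F n2 / F q2 = F (n1 * q2 - n2 * q1) / F (q1 * q2).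
Proof. by move=> h1 h2; rewrite rmorphB !rmorphM; field; rewrite h1 h2. Qed.

Lemma rmorph_subf_deriv (n1 n2 q1 q2 n1' n2' q1' q2' : A) : F q1 != 0 -> F q2 != 0 ->
  F ((n1' * q2 + n1 * q2' - (n2' * q1 + n2 * q1')) * (q1 * q2)
    - (n1 * q2 - n2 * q1) * (q1' * q2 + q1 * q2')) / F ((q1 * q2) ^+ 2) =
  F (n1' * q1 - n1 * q1') / F (q1 ^+ 2) - F (n2' * q2 - n2 * q2') / F (q2 ^+ 2).
Proof.
move=> h1 h2; rewrite !(rmorphB, rmorphD, rmorphXn, rmorphM) /=; field.
by rewrite h1 h2.
Qed.

Lemma rmorph_divf_cancel (n q h : A) : F q != 0 -> F h != 0 ->
  F n / F q = F (n * h) / F (q * h).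
Proof. by move=> h1 h2; rewrite !rmorphM; field; rewrite h1 h2. Qed.

End FractionIdentities.

Definition tofr (R : realType) : {rmorphism {poly R} -> ratfun R} := @tofrac {poly R}.

Section RationalFunctions.

Variable R : realType.
Implicit Types (a b : ratfun R) (f : R -> R) (J : set R).

Lemma ratfunP a : exists n q : {poly R}, q != 0 /\ a = tofrac n / tofrac q.
Proof.
exists (fraction.frac (generic_quotient.repr a)).1, (fraction.frac (generic_quotient.repr a)).2.
by split; [exact: denom_ratioP|exact: ratfun_repr].
Qed.

Lemma Rx_derivB a b : Rx_deriv (a - b) = Rx_deriv a - Rx_deriv b.
Proof.
have [n1 [q1 [q10 ->]]] := ratfunP a; have [n2 [q2 [q20 ->]]] := ratfunP b.
have t1 : tofrac q1 != 0 by rewrite tofrac_eq0.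
have t2 : tofrac q2 != 0 by rewrite tofrac_eq0.
rewrite [X in Rx_deriv X](rmorph_subf (F := @tofr R) n1 n2 t1 t2).
have q12 : q1 * q2 != 0 by rewrite mulf_neq0.
rewrite (Rx_derivE _ q10) (Rx_derivE _ q20) (Rx_derivE _ q12) !(derivB, derivM).
exact: (rmorph_subf_deriv (F := @tofr R) _ _ _ _ _ _ t1 t2).
Qed.

(** Links the algebraic derivation with the analytic derivative, so that [star] can be tested at
    points. *)
Lemma restricts_deriv a J f : open J -> (exists t, J t) -> restricts a J f ->
  restricts (Rx_deriv a) J (derive1 f).
Proof.
move=> oJ [t0 Jt0] [n [q [-> H]]].
have q0 : q != 0 by apply/eqP => q0; have [] := H t0 Jt0; rewrite q0 horner0.
exists (n^`() * q - n * q^`()), (q ^+ 2); split; first exact: Rx_derivE.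
move=> t Jt; split.
  by apply/eqP; rewrite horner_exp expf_neq0 //; apply/eqP; case: (H t Jt).
(* The exponent 1 brings the quotient into the form of [is_derive_div_poly_exp]. *)
rewrite (eq_on_derive1 oJ (g := fun t => n.[t] / q.[t] ^+ 1)) //; last by move=> u /H[].
move: t Jt; apply: is_derive_on_derive1 => u Ju.
have qu : q.[u] != 0 by apply/eqP; case: (H u Ju).
apply: (is_derive_eq (is_derive_div_poly_exp 1 (is_derive_poly n u) qu)).
rewrite horner_exp !hornerE; congr (_ / _); ring.
Qed.

(** The product of the three separate denominators serves for the function and both derivatives, so
    that identities at points can be cleared of denominators. *)
Lemma restricts_common_denominator a J f : open J -> (exists t, J t) -> restricts a J f ->
  exists g f0 f1 f2 : {poly R},
    [/\ g != 0, a = tofrac f0 / tofrac g, Rx_deriv a = tofrac f1 / tofrac g,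
        Rx_deriv (Rx_deriv a) = tofrac f2 / tofrac g &
        forall t, J t -> [/\ g.[t] != 0, f t = f0.[t] / g.[t],
          derive1 f t = f1.[t] / g.[t] & derive1n 2 f t = f2.[t] / g.[t]]].
Proof.
move=> oJ Jn r0; have r1 := restricts_deriv oJ Jn r0; have r2 := restricts_deriv oJ Jn r1.
case: r0 r1 r2 => [n0 [q0 [-> H0]]] [n1 [q1 [-> H1]]] [n2 [q2 [-> H2]]].
have [t0 Jt0] := Jn.
have nz (q : {poly R}) : q.[t0] <> 0 -> q != 0.
  by move=> H; apply/eqP => E; apply: H; rewrite E horner0.
have q0n := nz _ (proj1 (H0 _ Jt0)); have q1n := nz _ (proj1 (H1 _ Jt0)).
have q2n := nz _ (proj1 (H2 _ Jt0)).
have fr (q : {poly R}) : q != 0 -> tofrac q != 0 by rewrite tofrac_eq0.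
exists (q0 * (q1 * q2)), (n0 * (q1 * q2)), (n1 * (q0 * q2)), (n2 * (q0 * q1)); split.
- by rewrite !mulf_neq0.
- by apply: (rmorph_divf_cancel (F := @tofr R)); rewrite fr ?mulf_neq0.
- rewrite (_ : q0 * (q1 * q2) = q1 * (q0 * q2)); last by ring.
  by apply: (rmorph_divf_cancel (F := @tofr R)); rewrite fr ?mulf_neq0.
- rewrite (_ : q0 * (q1 * q2) = q2 * (q0 * q1)); last by ring.
  by apply: (rmorph_divf_cancel (F := @tofr R)); rewrite fr ?mulf_neq0.
move=> t Jt; have [/eqP a0 ->] := H0 t Jt; have [/eqP a1 ->] := H1 t Jt.
have [/eqP a2] := H2 t Jt; rewrite /= => ->.
rewrite !hornerM; split; [by rewrite !mulf_neq0|field; by rewrite a0 a1 a2..].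
Qed.

End RationalFunctions.

(** * Functions rational on a set, and their continuation *)

Section RationalOn.

Variables (R : realType) (J : set R).
Implicit Types (f g : R -> R).

(** The denominator has no zero on [J]: regularity at an added point is what permits continuation to
    it. *)
Definition rational_on f : Prop :=
  exists n q : {poly R}, forall t, J t -> q.[t] != 0 /\ f t = n.[t] / q.[t].

Lemma rational_on_poly (p : {poly R}) : rational_on (horner p).
Proof. by exists p, 1 => t _; rewrite hornerC oner_eq0 divr1. Qed.

Lemma eq_rational_on f g : (forall t, J t -> f t = g t) -> rational_on f -> rational_on g.
Proof. by move=> fg [n [q H]]; exists n, q => t Jt; rewrite -fg //; exact: H. Qed.

Lemma rational_on_cst c : rational_on (fun=> c).
Proof. by apply: eq_rational_on (rational_on_poly c%:P) => t _; rewrite hornerC. Qed.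

Lemma rational_onD f g : rational_on f -> rational_on g -> rational_on (fun t => f t + g t).
Proof.
move=> [n [q H]] [n' [q' H']]; exists (n * q' + n' * q), (q * q') => t Jt.
have [q0 ->] := H t Jt; have [q0' ->] := H' t Jt.
by rewrite !(hornerM, hornerD); split; [rewrite mulf_neq0|field; rewrite q0 q0'].
Qed.

Lemma rational_onM f g : rational_on f -> rational_on g -> rational_on (fun t => f t * g t).
Proof.
move=> [n [q H]] [n' [q' H']]; exists (n * n'), (q * q') => t Jt.
have [q0 ->] := H t Jt; have [q0' ->] := H' t Jt.
by rewrite !(hornerM, hornerD); split; [rewrite mulf_neq0|field; rewrite q0 q0'].
Qed.

Lemma rational_onN f : rational_on f -> rational_on (fun t => - f t).
Proof.
move=> H; apply: eq_rational_on (rational_onM (rational_on_cst (-1)) H) => t _.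
by rewrite mulN1r.
Qed.

Lemma rational_onV f : rational_on f -> (forall t, J t -> f t != 0) ->
  rational_on (fun t => (f t)^-1).
Proof.
move=> [n [q H]] f0; exists q, n => t Jt; have [q0 E] := H t Jt.
have := f0 t Jt; rewrite E mulf_eq0 negb_or => /andP[n0 _]; split=> //.
by rewrite invf_div.
Qed.

Lemma rational_on_sum (U : Type) (l : seq U) (P : pred U) (F : U -> R -> R) :
  (forall u, P u -> rational_on (F u)) -> rational_on (fun t => \sum_(u <- l | P u) F u t).
Proof.
move=> H; elim: l => [|u l IH].
  by apply: eq_rational_on (rational_on_cst 0) => t _; rewrite big_nil.
have [Pu|Pu] := boolP (P u).
  by apply: eq_rational_on (rational_onD (H u Pu) IH) => t _; rewrite big_cons Pu.
by apply: eq_rational_on IH => t _; rewrite big_cons (negbTE Pu).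
Qed.

Lemma rational_on_restricts f : rational_on f -> exists a, restricts a J f.
Proof.
move=> [n [q H]]; exists (tofrac n / tofrac q), n, q; split=> // t Jt.
by have [/eqP q0 ->] := H t Jt.
Qed.

End RationalOn.

(** After cross-multiplication the difference is a polynomial vanishing on [J], hence zero, and both
    denominators are non-zero at [t0]. *)
Lemma rational_on_continuation (R : realType) (J : set R) (t0 : R) (f g : R -> R) :
  unisolvent J -> rational_on (J `|` [set t0]) f -> rational_on (J `|` [set t0]) g ->
  (forall t, J t -> f t = g t) -> f t0 = g t0.
Proof.
move=> HJ [n [q H]] [n' [q' H']] fg.
have /eqP : n * q' - n' * q = 0.
  apply: HJ => t Jt; have [q0 E] := H t (or_introl Jt); have [q0' E'] := H' t (or_introl Jt).
  move: (fg t Jt); rewrite E E' => /eqP; rewrite eqr_div // => /eqP EE.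
  by rewrite !hornerE EE subrr.
rewrite subr_eq0 => /eqP/(congr1 (horner^~ t0)); rewrite !hornerM => EE.
have [q0 ->] := H t0 (or_intror erefl); have [q0' ->] := H' t0 (or_intror erefl).
by apply/eqP; rewrite eqr_div // EE.
Qed.

(** * The extremality equation in terms of polynomials *)

Lemma mderiv_tpair0 (R : realType) (n : nat) (i : 'I_n) (T : finType)
    (y : T -> mpoly.mpoly n R) (t : tensor R T) :
  (forall s, mderiv i (y s) = 0) -> mderiv i (tpair (mpolyC n (R := R)) y t) = 0.
Proof.
move=> y0; rewrite /tpair raddf_sum big1 // => c _.
rewrite /= mpoly.mderiv_mulC; set F := (\prod_s _).
suff -> : mderiv i F = 0 by rewrite mulr0.
apply: (big_ind (fun F => mderiv i F = 0)) => [|f g f0 g0|s _].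
- by rewrite -mpoly.mpolyC1 mpoly.mderivC.
- by rewrite mpoly.mderivM f0 g0 mul0r mulr0 addr0.
- by case: ifP => _ //; rewrite -mpoly.mpolyC1 mpoly.mderivC.
Qed.

Lemma mderiv_var (R : realType) (T : finType) (s u : T) :
  mderiv (enum_rank s) (var R u) = (u == s)%:R.
Proof.
apply/eqP; rewrite -subr_eq0; apply/eqP/ev_eq0 => x.
rewrite rmorphB /= (ev_restr s) -deriv_restr restrX enum_rankK rmorph_nat.
by case: eqP => _; rewrite ?derivX ?derivC hornerE subrr.
Qed.

Section Equation.

Variables (R : realType) (k : nat) (d : 'I_k -> nat).
Variable Gam : forall j, tensor R (slots d (off predT j)).
Variable be : Vdual R d.

Local Notation mp := (mpoly.mpoly #|slot d| R).
Local Notation m1 := ((slots_dim d + 1)%:R).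
Local Notation m2 := ((slots_dim d + 2)%:R).
Local Notation "''d_' s" := (mderiv (enum_rank s)) (at level 0, s at level 2).

Lemma ev_mu_poly (al : Vdual R d) x : ev x (mu_poly al) = mu x al.
Proof. by rewrite rmorph_tpair; apply: eq_tpair => s /=; rewrite ?evC ?ev_var. Qed.

Definition muhat_poly (j : 'I_k) : mp :=
  tpair (mpolyC #|slot d| (R := R)) (fun s : slots d (off predT j) => var R (val s)) (Gam j).

Lemma ev_muhat_poly j x : ev x (muhat_poly j) = muhat Gam x j.
Proof. by rewrite rmorph_tpair; apply: eq_tpair => s /=; rewrite ?evC ?ev_var. Qed.

Definition weight_poly : mp := \prod_(j < k) muhat_poly j ^+ d j.

Lemma ev_weight_poly x : ev x weight_poly = \prod_(j < k) muhat Gam x j ^+ d j.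
Proof. by rewrite rmorph_prod; apply: eq_bigr => j _; rewrite rmorphXn /= ev_muhat_poly. Qed.

Definition Delta_poly (s : slot d) : mp :=
  \prod_(r < d (tag s) | r != tagged s) (var R s - var R (mkslot r)).

Lemma ev_Delta_poly i (r : 'I_(d i)) x : ev x (Delta_poly (mkslot r)) = Delta x r.
Proof. by rewrite rmorph_prod; apply: eq_bigr => u _; rewrite rmorphB /= !ev_var. Qed.

(** By multilinearity: [B0] is the pairing with 0 put in slot [s], and the slope is the difference
    of the values at 1 and at 0. *)
Lemma mu_poly_affine (al : Vdual R d) (s : slot d) :
  exists B0 : mp, mu_poly al = B0 + var R s * 'd_s (mu_poly al) /\
    'd_s ('d_s (mu_poly al)) = 0 /\ 'd_s B0 = 0.
Proof.
pose y (u : slots d predT) := var R (val u).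
pose B0 := tpair (mpolyC #|slot d| (R := R)) [eta y with exist _ s isT |-> 0] al.
pose B1 := tpair (mpolyC #|slot d| (R := R)) [eta y with exist _ s isT |-> 1] al - B0.
have E : mu_poly al = B0 + var R s * B1.
  by rewrite /mu_poly (tpair_affine _ _ _ (exist _ s isT : slots d predT)).
have dy c : 'd_s c = 0 -> forall u, 'd_s ([eta y with exist _ s isT |-> c] u) = 0.
  move=> dc u /=; case: ifP => // us; rewrite mderiv_var -val_eqE /= in us *.
  by rewrite us.
have d0 : 'd_s B0 = 0 by apply/mderiv_tpair0/dy; rewrite raddf0.
have d1 : 'd_s B1 = 0.
  by rewrite raddfB /= d0 subr0; apply/mderiv_tpair0/dy; rewrite -mpoly.mpolyC1 mpoly.mderivC.
have dE : 'd_s (mu_poly al) = B1.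
  by rewrite E mpoly.mderivD mpoly.mderivM d0 d1 mderiv_var eqxx mul1r mulr0 add0r addr0.
by exists B0; rewrite dE.
Qed.

(* With [P = \prod_j <\hat x_j, Gam_j>^(d_j)], the polynomials below are the coefficients of
   [a], [2 a'], [a''] in [<mu,be>^(m+3) (a P / <mu,be>^(m+1))''], the derivative being
   along the slot [s]. *)
Definition term_coef0 (s : slot d) : mp :=
  mu_poly be ^+ 2 * 'd_s ('d_s weight_poly)
  - 2 * m1 * (mu_poly be * 'd_s (mu_poly be) * 'd_s weight_poly)
  + m1 * m2 * ('d_s (mu_poly be) ^+ 2 * weight_poly).
Definition term_coef1 (s : slot d) : mp :=
  mu_poly be ^+ 2 * 'd_s weight_poly - m1 * (mu_poly be * 'd_s (mu_poly be) * weight_poly).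
Definition term_coef2 (s : slot d) : mp := mu_poly be ^+ 2 * weight_poly.

(** Reals stand for the values of the solution and its derivatives, so that the dependence on [x] is
    polynomial. *)
Definition term (s : slot d) (a0 a1 a2 : R) (x : slot d -> R) : R :=
  a2 * ev x (term_coef2 s) + 2 * a1 * ev x (term_coef1 s) + a0 * ev x (term_coef0 s).

Variables (I : slot d -> set R) (A : slot d -> R -> R).

Definition box (x : slot d -> R) : Prop := forall s, I s (x s).

Lemma box_update x s t : box x -> I s t -> box [eta x with s |-> t].
Proof. by move=> bx It u /=; case: eqP => [->|]. Qed.

Definition sol_term (s : slot d) (x : slot d -> R) : R :=
  term s (A s (x s)) (derive1 (A s) (x s)) (derive1n 2 (A s) (x s)) x.

Hypothesis A_sol : extremality_solution Gam be I A.

Lemma partial2_sol s x : box x ->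
  mu x be ^+ (slots_dim d + 3) *
  partial2 s (fun y => A s (y s) / mu y be ^+ (slots_dim d + 1) *
                \prod_(j < k) muhat Gam y j ^+ d j) x = sol_term s x.
Proof.
move=> bx; have [HI HA Hn _] := A_sol.
have [oI _ _] := HI s; have [smA _] := HA s.
pose b := restr s x (mu_poly be); pose g := restr s x weight_poly.
rewrite /partial2 (_ : (fun t => _) =
    (fun t => A s t / b.[t] ^+ (slots_dim d + 1) * g.[t])); last first.
  by apply/funext => t; rewrite /= eqxx !horner_restr ev_mu_poly ev_weight_poly.
have b0 u : I s u -> b.[u] != 0.
  move=> Iu; rewrite horner_restr ev_mu_poly; apply/eqP.
  by have [_ _] := Hn _ (box_update bx Iu).
have b2 : b^`()^`() = 0.
  by rewrite !deriv_restr; have [B0 [_ [-> _]]] := mu_poly_affine be s; rewrite rmorph0.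
rewrite (derive1n2_div_poly_exp g _ oI _ b0 b2 (bx s)); last first.
  by move=> u Iu; split; [exact: (smA 0%N u Iu)|exact: (smA 1%N u Iu)].
rewrite !deriv_restr -!ev_restr.
(* Two derivatives raise the exponent m+1 of the denominator to m+3, which the factor in (E)
   cancels. *)
have -> : (slots_dim d + 3 = (slots_dim d + 1).+2)%N by rewrite !addnS.
rewrite -[mu x be]ev_mu_poly mulrC divfK; last first.
  by rewrite expf_neq0 // (ev_restr s); exact: b0.
rewrite /sol_term /term /term_coef0 /term_coef1 /term_coef2.
rewrite !(rmorphD, rmorphB, rmorphM, rmorphXn, rmorph_nat) /= -(addnS _ 1%N); ring.
Qed.

Definition sol_den (s : slot d) (x : slot d -> R) : R :=
  ev x (Delta_poly s) * ev x (muhat_poly (tag s)) * ev x weight_poly.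

Lemma sol_equation : exists al : Vdual R d, forall x, box x ->
  \sum_s sol_term s x / sol_den s x = mu x al.
Proof.
have [_ _ _ [al _ E]] := A_sol; exists al => x bx; rewrite -E // /extremality_lhs.
rewrite sig_big_dep /=; apply: eq_bigr => -[i r] _ /=.
rewrite -partial2_sol // /sol_den ev_Delta_poly ev_muhat_poly ev_weight_poly.
by rewrite [LHS]mulrAC.
Qed.

End Equation.

(** * Dependence on the variables of group p *)

Lemma mkslot_inj (k : nat) (d : 'I_k -> nat) (i : 'I_k) : injective (@mkslot k d i).
Proof. by move=> a b H; apply: eq_from_Tagged H. Qed.

Section GroupedSlots.

Variables (R : realType) (k : nat) (d : 'I_k -> nat).
Variable Gam : forall j, tensor R (slots d (off predT j)).
Variable be : Vdual R d.
Variables (p : 'I_k) (e : 'I_k -> 'rV[R]_2).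
Variable Gamt : forall j, tensor R (slots d (off (off predT j) p)).
Hypothesis Gam_dec : forall (j : 'I_k) (pj : p != j),
  Gam j = @ins R k d (off predT j) p pj (Gamt j) (tpow (d p) (e j)).

Local Notation mp := (mpoly.mpoly #|slot d| R).
Local Notation m1 := ((slots_dim d + 1)%:R).
Local Notation m2 := ((slots_dim d + 2)%:R).
Local Notation "''d_' s" := (mderiv (enum_rank s)) (at level 0, s at level 2).
Local Notation W := (weight_poly Gam).

(* [S = L' / L] for [L = \prod_(j != p) <(1,x),e_j>^(d_j)]. *)
Definition lin (j : 'I_k) : {poly R} := (e j ord0 0)%:P + 'X * (e j ord0 1)%:P.
Definition lin_weight : {poly R} := \prod_(j < k | j != p) lin j ^+ d j.

Lemma muhat_dec (x : slot d -> R) (j : 'I_k) : j != p ->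
  muhat Gam x j = \prod_(r < d p) (lin j).[x (mkslot r)] *
    tpair id (fun s => x (val (slots_widen s))) (Gamt j).
Proof.
rewrite eq_sym => pj; rewrite /muhat (Gam_dec pj) (tpair_ins idfun) tpair_tpow.
by congr (_ * _); apply: eq_bigr => r _; rewrite !hornerE.
Qed.

(** The variable x_pr enters [muhat] only through the factor [lin j]; the form without division
    stays valid where that factor vanishes. *)
Lemma muhat_update (x : slot d -> R) (r : 'I_(d p)) t (j : 'I_k) : j != p ->
  muhat Gam [eta x with mkslot r |-> t] j * (lin j).[x (mkslot r)] =
  muhat Gam x j * (lin j).[t].
Proof.
move=> jp; rewrite !muhat_dec // (bigD1 r) //= [in RHS](bigD1 r) //= eqxx.
have -> : tpair id (fun s : slots d (off (off predT j) p) =>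
    if val s == mkslot r then t else x (val s)) (Gamt j) =
  tpair id (fun s => x (val s)) (Gamt j).
  apply: eq_tpair => // s; case: eqP => // E.
  by case/andP: (valP s); rewrite E /= eqxx.
under eq_bigr => u ur.
  have -> : (mkslot u == mkslot r) = false.
    by rewrite (inj_eq (@mkslot_inj _ _ _)) (negbTE ur).
over.
ring.
Qed.

Lemma muhat_update_self (x : slot d -> R) (r : 'I_(d p)) t :
  muhat Gam [eta x with mkslot r |-> t] p = muhat Gam x p.
Proof.
apply: eq_tpair => // s /=; case: eqP => // E.
by move: (valP s); rewrite /= E /off /= eqxx.
Qed.

Lemma weight_update (x : slot d -> R) (r : 'I_(d p)) t :
  ev [eta x with mkslot r |-> t] W * lin_weight.[x (mkslot r)] = ev x W * lin_weight.[t].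
Proof.
rewrite !ev_weight_poly (bigD1 p) //= [in RHS](bigD1 p) //= muhat_update_self.
rewrite !horner_prod -!mulrA -!big_split /=; congr (_ * _); apply: eq_bigr => j jp.
by rewrite !horner_exp -!exprMn muhat_update.
Qed.

(** By [weight_update], [W] along slot (p,r) is proportional to [lin_weight]; this identity of
    univariate polynomials is differentiated twice. *)
Lemma weight_deriv (x : slot d -> R) (r : 'I_(d p)) :
  ev x ('d_(mkslot r) W) * lin_weight.[x (mkslot r)] = ev x W * lin_weight^`().[x (mkslot r)] /\
  ev x ('d_(mkslot r) ('d_(mkslot r) W)) * lin_weight.[x (mkslot r)] =
    ev x W * lin_weight^`()^`().[x (mkslot r)].
Proof.
set s := mkslot r.
have E : restr s x W * (lin_weight.[x s])%:P = (ev x W)%:P * lin_weight.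
  apply/eqP; rewrite -subr_eq0; apply/eqP.
  apply: (@unisolvent_open R setT); [exact: openT|by exists 0|] => t _.
  by rewrite hornerD hornerN !hornerM !hornerC horner_restr weight_update subrr.
have E1 := congr1 (@deriv R) E.
rewrite !derivM !derivC mulr0 mul0r addr0 add0r in E1.
have E2 := congr1 (@deriv R) E1.
rewrite !derivM !derivC mulr0 mul0r addr0 add0r in E2.
move/(congr1 (horner^~ (x s))): E1; move/(congr1 (horner^~ (x s))): E2.
by rewrite !deriv_restr !hornerM !hornerC -!ev_restr.
Qed.

Lemma muhat_lin_neq0 (x : slot d -> R) (r : 'I_(d p)) (j : 'I_k) : j != p ->
  muhat Gam x j != 0 -> (lin j).[x (mkslot r)] != 0.
Proof.
by move=> jp; apply: contra_neq => l0; rewrite muhat_dec // (bigD1 r) //= l0 !mul0r.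
Qed.

Lemma lin_weight_neq0 (x : slot d -> R) (r : 'I_(d p)) :
  (forall j, muhat Gam x j != 0) -> lin_weight.[x (mkslot r)] != 0.
Proof.
move=> mu0; rewrite horner_prod; apply/prodf_neq0 => j jp.
by rewrite horner_exp expf_neq0 // muhat_lin_neq0.
Qed.

(** [red0], [red1], [red2] are the coefficients of b^2, b b', b'^2 in [term] multiplied by L / P;
    they depend on the single variable x_pr. *)
Definition red0 (a0 a1 a2 L L' L'' : R) : R := a2 * L + 2 * a1 * L' + a0 * L''.
Definition red1 (a0 a1 L L' : R) : R := - (2 * m1 * (a1 * L + a0 * L')).
Definition red2 (a0 L : R) : R := m1 * m2 * a0 * L.

Lemma term_grouped (r : 'I_(d p)) (a0 a1 a2 : R) (x : slot d -> R) :
  let s := mkslot r in let t := x s in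
  let b := ev x (mu_poly be) in let b' := ev x ('d_s (mu_poly be)) in
  let L := lin_weight.[t] in let L' := lin_weight^`().[t] in let L'' := lin_weight^`()^`().[t] in
  term Gam be s a0 a1 a2 x * L =
  ev x W * (red0 a0 a1 a2 L L' L'' * b ^+ 2 + red1 a0 a1 L L' * (b * b') + red2 a0 L * b' ^+ 2).
Proof.
move=> s t b b' L L' L''; have [E1 E2] := weight_deriv x r.
rewrite /term /term_coef0 /term_coef1 /term_coef2 /red0 /red1 /red2.
rewrite !(rmorphB, rmorphM, rmorphXn, rmorph_nat, rmorphD) /= -/b -/b'.
move: E1 E2; rewrite -/s -/t -/L -/L' -/L''.
set w := ev x W; set w' := ev x ('d_s W); set w'' := ev x ('d_s ('d_s W)) => E1 E2.
transitivity (a2 * (b ^+ 2 * (w * L)) + 2 * a1 * (b ^+ 2 * (w' * L) - m1 * (b * b' * (w * L)))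
  + a0 * (b ^+ 2 * (w'' * L) - 2 * m1 * (b * b' * (w' * L)) + m1 * m2 * (b' ^+ 2 * (w * L)))).
  ring.
by rewrite E1 E2; ring.
Qed.

(** Isolates the factor that vanishes on the diagonal. *)
Lemma Delta_poly_split (q r : 'I_(d p)) : q != r ->
  Delta_poly R (mkslot q) = (var R (mkslot q) - var R (mkslot r)) *
    \prod_(u < d p | (u != q) && (u != r)) (var R (mkslot q) - var R (mkslot u)).
Proof. by move=> qr; rewrite /Delta_poly (bigD1 r) //= eq_sym. Qed.

Variables (I : slot d -> set R) (A : slot d -> R -> R).
Hypothesis A_sol : extremality_solution Gam be I A.

Lemma box_distinct (x : slot d -> R) (i : 'I_k) (u v : 'I_(d i)) :
  box I x -> u != v -> x (mkslot u) != x (mkslot v).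
Proof.
rewrite eq_sym => bx vu; have [_ _ /(_ x bx)[/(_ i u)/eqP + _ _] _] := A_sol.
by apply: contra_neq => E; rewrite /Delta (bigD1 v) //= E subrr mul0r.
Qed.

Lemma box_muhat_neq0 (x : slot d -> R) j : box I x -> muhat Gam x j != 0.
Proof. by move=> bx; have [_ _ /(_ x bx)[_ /(_ j)/eqP]] := A_sol. Qed.

Lemma rational_on_ev (J : set R) (x : slot d -> R) s (F : mp) :
  rational_on J (fun t => ev [eta x with s |-> t] F).
Proof. by apply: eq_rational_on (rational_on_poly J (restr s x F)) => t _; rewrite horner_restr. Qed.

(** [H] is the summand of slot [s] as determined by (E) from all the others. The pole at t = x_u
    coming from the summand of [u] cancels, since Delta_s / Delta_u = - Dq / Dr. The point x_u is
    added to the domain because it need not lie in [I s]. *)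
Lemma term_continuation (q r : 'I_(d p)) (x : slot d -> R) : q != r -> box I x ->
  let s := mkslot q in let u := mkslot r in
  exists H : R -> R,
    [/\ rational_on (I s `|` [set x u]) H,
        forall t, I s t -> sol_term Gam be A s [eta x with s |-> t] = H t &
        H (x u) = sol_term Gam be A u [eta x with s |-> x u]].
Proof.
move=> qr bx s u.
have us : (u == s) = false by rewrite (inj_eq (@mkslot_inj _ _ _)) eq_sym (negbTE qr).
have [al E] := sol_equation A_sol.
pose Xt t := [eta x with s |-> t].
have Xts t : Xt t s = t by rewrite /= eqxx.
have XtN t v : v != s -> Xt t v = x v by rewrite /= => /negbTE ->.
have Xtu t : Xt t u = x u by rewrite XtN // us.
have bXt t : I s t -> box I (Xt t) by exact: box_update.
pose Dq : mp := \prod_(v < d p | (v != q) && (v != r)) (var R s - var R (mkslot v)).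
pose Dr : mp := \prod_(v < d p | (v != r) && (v != q)) (var R u - var R (mkslot v)).
have DqE : Delta_poly R s = (var R s - var R u) * Dq by exact: Delta_poly_split.
have DrE : Delta_poly R u = (var R u - var R s) * Dr.
  by apply: Delta_poly_split; rewrite eq_sym.
pose J := (I s `|` [set x u])%classic.
(* At t = x_u the point may leave the box; [muhat_update] transports the non-vanishing from [x]. *)
have muJ t j : J t -> ev (Xt t) (muhat_poly Gam j) != 0.
  rewrite ev_muhat_poly => -[It|->]; first exact: box_muhat_neq0 (bXt t It).
  have [->|jp] := eqVneq j p; first by rewrite muhat_update_self; exact: box_muhat_neq0.
  have := muhat_update x q (x u) jp; apply: contra_eq_neq => ->.
  by rewrite mul0r eq_sym mulf_neq0 ?(box_muhat_neq0 _ bx) ?muhat_lin_neq0 ?(box_muhat_neq0 _ bx).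
have WJ t : J t -> ev (Xt t) W != 0.
  move=> Jt; rewrite rmorph_prod; apply/prodf_neq0 => j _.
  by rewrite rmorphXn expf_neq0 // muJ.
(* At t = x_u, slot [s] carries the value of [u], from which the other slots of the group differ
   already at [x]. *)
have distJ t i (a b : 'I_(d i)) : J t -> a != b -> mkslot a != s -> mkslot a != u ->
    Xt t (mkslot a) != Xt t (mkslot b).
  move=> [It|->] ab as_ au; first exact: box_distinct (bXt t It) ab.
  rewrite XtN //; have [bs|bs] := eqVneq (mkslot b) s.
    have ip : i = p by case: bs.
    subst i; rewrite bs Xts; apply: (box_distinct bx).
    by apply: contraNneq au => ->.
  by rewrite XtN //; apply: (box_distinct bx).
have DeltaJ t v : J t -> v != s -> v != u -> ev (Xt t) (Delta_poly R v) != 0.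
  case: v => i a Jt vs vu; rewrite rmorph_prod; apply/prodf_neq0 => b /= ba.
  by rewrite rmorphB /= !ev_var subr_eq0; apply: distJ => //; rewrite eq_sym.
have DrJ t : J t -> ev (Xt t) Dr != 0.
  move=> Jt; rewrite rmorph_prod; apply/prodf_neq0 => b /andP[br bq].
  rewrite rmorphB /= !ev_var subr_eq0 eq_sym; apply: distJ => //.
    by apply: contra bq => /eqP/mkslot_inj ->.
  by apply: contra br => /eqP/mkslot_inj ->.
(* (E) solved for the summand of [s]; the last term is the contribution of [u], simplified by
   Delta_s / Delta_u = - Dq / Dr. *)
pose H t := ev (Xt t) (Delta_poly R s * muhat_poly Gam p * W) *
    (ev (Xt t) (mu_poly al) + - \sum_(v | (v != s) && (v != u))
       sol_term Gam be A v (Xt t) * (sol_den Gam v (Xt t))^-1) +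
  ev (Xt t) Dq * (ev (Xt t) Dr)^-1 * sol_term Gam be A u (Xt t).
(* For [v] other than [s] the argument of [A v] is frozen, so only polynomials vary with t. *)
have termJ v : v != s -> rational_on J (fun t => sol_term Gam be A v (Xt t)).
  move=> vs; apply: (@eq_rational_on _ _ (fun t => term Gam be v (A v (x v))
    (derive1 (A v) (x v)) (derive1n 2 (A v) (x v)) (Xt t))).
    by move=> t _; rewrite /sol_term XtN.
  rewrite /term.
  apply: rational_onD; first apply: rational_onD.
  - by apply: rational_onM; [exact: rational_on_cst|exact: rational_on_ev].
  - by apply: rational_onM; [exact: rational_on_cst|exact: rational_on_ev].
  - by apply: rational_onM; [exact: rational_on_cst|exact: rational_on_ev].
exists H; split.
- apply: rational_onD.
    apply: rational_onM; first exact: rational_on_ev.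
    apply: rational_onD; first exact: rational_on_ev.
    apply: rational_onN; apply: rational_on_sum => v /andP[vs vu].
    apply: rational_onM; first exact: termJ.
    apply: rational_onV => [|t Jt].
      by rewrite /sol_den; do !apply: rational_onM; exact: rational_on_ev.
    by rewrite !mulf_neq0 ?DeltaJ ?muJ ?WJ.
  apply: rational_onM; last by apply: termJ; rewrite us.
  apply: rational_onM; first exact: rational_on_ev.
  by apply: rational_onV => //; exact: rational_on_ev.
- move=> t It; have Jt : J t by left.
  have := E _ (bXt t It); rewrite (bigD1 s) //= (bigD1 u) ?us //=.
  rewrite -[X in _ = X]ev_mu_poly => /esym Et; rewrite /H Et.
  set S := \sum_(_ | _) _; set Ts := sol_term _ _ _ s _; set Tu := sol_term _ _ _ u _.
  rewrite /sol_den DqE DrE !rmorphM /=.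
  have sub : t - x u != 0.
    have := box_distinct (bXt t It) qr.
    by rewrite -/s -/u Xts Xtu subr_eq0.
  have q0 : ev (Xt t) Dq != 0.
    have : ev (Xt t) (Delta_poly R s) != 0.
      rewrite ev_Delta_poly; have [_ _ /(_ _ (bXt t It))[/(_ p q)/eqP ? _ _] _] := A_sol.
      by [].
    by apply: contra_neq => D0; rewrite DqE rmorphM /= D0 mulr0.
  rewrite !rmorphB /= !ev_var Xts Xtu.
  have := muJ _ p Jt; have := WJ _ Jt; have := DrJ _ Jt.
  move: (ev _ Dr) (ev _ Dq) (ev _ W) (ev _ (muhat_poly Gam p)) q0 => dr dq w g q0 r0 w0 g0.
  rewrite -[x u - t]opprB; move: (t - x u) sub => h h0; field.
  by rewrite q0 r0 w0 g0 h0.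
(* The factor t - x_u of Delta_s vanishes and [Dq] equals [Dr], so exactly the summand of [u]
   remains. *)
- have Ju : J (x u) by right.
  rewrite /H DqE !rmorphM rmorphB /= !ev_var Xts Xtu subrr !mul0r add0r.
  suff -> : ev (Xt (x u)) Dq = ev (Xt (x u)) Dr by rewrite divff ?mul1r // DrJ.
  rewrite !rmorph_prod (eq_bigl _ _ (fun v => andbC (v != q) (v != r))).
  by apply: eq_bigr => v _; rewrite !rmorphB /= !ev_var Xts Xtu.
Qed.

End GroupedSlots.

(** * Linear algebra for solving for rational coefficients *)

Lemma subspace_full (R : fieldType) (n : nat) (P : 'rV[R]_n -> Prop) :
  P 0 -> (forall a v w, P v -> P w -> P (a *: v + w)) ->
  (forall c : 'cV[R]_n, (forall v, P v -> v *m c = 0) -> c = 0) -> forall v, P v.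
Proof.
move=> P0 PL Pc.
(* The row space of a matrix of maximal rank with rows in [P] contains all of [P]; the columns of
   its cokernel then annihilate [P], hence are zero. *)
pose Q (l : nat) := `[< exists2 M : 'M[R]_n, (forall i, P (row i M)) & (\rank M = l) >].
have Q0 : exists l, Q l.
  by exists 0%N; apply/asboolP; exists 0; rewrite ?mxrank0 // => i; rewrite row0.
have Qn l : Q l -> (l <= n)%N by move=> /asboolP[M _ <-]; exact: rank_leq_row.
have [l /asboolP[M PM rM] lmax] := ex_maxnP Q0 Qn.
have PS m (M' : 'M[R]_(m, n)) : (forall i, P (row i M')) -> forall v, (v <= M')%MS -> P v.
  move=> PM' v /submxP[D ->]; rewrite mulmx_sum_row.
  by elim/big_ind: _ => // [v1 v2 P1 P2|i _]; [rewrite -[v1]scale1r; exact: PL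
    |rewrite -[_ *: _]addr0; exact: PL].
have Psub v : P v -> (v <= M)%MS.
  move=> Pv; have PM' : forall i, P (row i (col_mx M v)).
    move=> i; rewrite -(fintype.splitK i); case: (fintype.split i) => j /=.
      by rewrite rowKu.
    by rewrite rowKd row_id.
  have /lmax : Q (\rank (M + v)%MS).
    apply/asboolP; exists (M + v)%MS => // i; apply: (PS _ _ PM').
    by rewrite -addsmxE row_sub.
  rewrite -rM => le; have := mxrank_leqif_sup (addsmxSl M v).
  by move=> /geq_leqif; rewrite le => /esym; apply: submx_trans; exact: addsmxSr.
have : cokermx M = 0.
  apply/matrixP => i j; have : col j (cokermx M) = 0.
    apply: Pc => v /Psub /submxP[D ->].
    by rewrite colE mulmxA -(mulmxA D) mulmx_coker mulmx0 mul0mx.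
  by move/matrixP/(_ i ord0); rewrite !mxE.
move=> co v; apply: (PS _ M PM); rewrite submxE co mulmx0.
by [].
Qed.

(** The triples making the combination rational form a subspace. The second hypothesis says that [S]
    spans, so the subspace contains the basis vectors. *)
Lemma rational_span3 (R : realType) (J : set R) (w0 w1 w2 : R -> R) (S : R -> R -> R -> Prop) :
  (forall a0 a1 a2, S a0 a1 a2 ->
     rational_on J (fun t => a0 * w0 t + a1 * w1 t + a2 * w2 t)) ->
  (forall c0 c1 c2, (forall a0 a1 a2, S a0 a1 a2 -> c0 * a0 + c1 * a1 + c2 * a2 = 0) ->
     [/\ c0 = 0, c1 = 0 & c2 = 0]) ->
  [/\ rational_on J w0, rational_on J w1 & rational_on J w2].
Proof.
move=> HS Hc.
pose o1 : 'I_3 := lift ord0 ord0; pose o2 : 'I_3 := lift ord0 (lift ord0 ord0).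
pose P (v : 'rV[R]_3) := rational_on J
  (fun t => v ord0 ord0 * w0 t + v ord0 o1 * w1 t + v ord0 o2 * w2 t).
have HP : forall v, P v.
  apply: subspace_full.
  - apply: eq_rational_on (rational_on_cst J 0) => t _; rewrite !mxE; ring.
  - move=> a v w Pv Pw.
    apply: eq_rational_on (rational_onD (rational_onM (rational_on_cst J a) Pv) Pw) => t _.
    rewrite !mxE; ring.
  move=> c Pc; have [] := Hc (c ord0 ord0) (c o1 ord0) (c o2 ord0).
    move=> a0 a1 a2 Sa.
    have /Pc/matrixP/(_ ord0 ord0) : P (\row_i [:: a0; a1; a2]`_i).
      by rewrite /P !mxE; exact: HS.
    rewrite !mxE !big_ord_recl big_ord0 !mxE /= => E.
    by rewrite -[RHS]E /o1 /o2; ring.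
  move=> c0 c1 c2; apply/colP => -[[|[|[|//]]] Hi]; rewrite mxE.
  - by rewrite -[RHS]c0; congr (c _ _); apply: val_inj.
  - by rewrite -[RHS]c1; congr (c _ _); apply: val_inj.
  - by rewrite -[RHS]c2; congr (c _ _); apply: val_inj.
have HPn (a0 a1 a2 : R) : rational_on J (fun t => a0 * w0 t + a1 * w1 t + a2 * w2 t).
  by have := HP (\row_i [:: a0; a1; a2]`_i); rewrite /P !mxE.
split.
- by apply: eq_rational_on (HPn 1 0 0) => t _; ring.
- by apply: eq_rational_on (HPn 0 1 0) => t _; ring.
- by apply: eq_rational_on (HPn 0 0 1) => t _; ring.
Qed.

(** * Symmetry of <mu,be> in the p-slots *)

Section Symmetry.

Variables (R : realType) (k : nat) (d : 'I_k -> nat).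
Variable Gam : forall j, tensor R (slots d (off predT j)).
Variables (p : 'I_k) (e : 'I_k -> 'rV[R]_2).
Variable Gamt : forall j, tensor R (slots d (off (off predT j) p)).
Hypothesis Gam_dec : forall (j : 'I_k) (pj : p != j),
  Gam j = @ins R k d (off predT j) p pj (Gamt j) (tpow (d p) (e j)).

(** In the summand of group [p] the exchange is absorbed by the symmetric tensor [u p]; in the
    others it permutes the factors [lin j] of [muhat]. *)
Lemma mu_tperm (be : Vdual R d) (q r : 'I_(d p)) (x : slot d -> R) :
  be \in hspace Gam ->
  mu (x \o tperm (mkslot q) (mkslot r)) be = mu x be.
Proof.
case/hspaceP => u Hu ->; rewrite /mu; set y := x \o _.
have fixed (v : slot d) : tag v != p -> y v = x v.
  move=> vp; rewrite /y /= tpermD //; by apply: contraNneq vp => <-.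
have yp (v : 'I_(d p)) : y (mkslot v) = x (mkslot (tperm q r v)).
  rewrite /y /=; congr x; case: (tpermP q r v) => [->|->|/eqP vq /eqP vr].
  - by rewrite tpermL.
  - by rewrite tpermR.
  - by rewrite tpermD // eq_sym (inj_eq (@mkslot_inj _ _ _)).
have E z : tpair id (z \o val) (\sum_j @ins R k d predT j isT (Gam j) (u j)) =
    \sum_j tpair id (fun v => z (mkslot v)) (u j) * muhat Gam z j.
  transitivity (\sum_j tpair id (z \o val) (@ins R k d predT j isT (Gam j) (u j))).
    rewrite /tpair exchange_big; apply: eq_bigr => c _.
    by rewrite sum_ffunE mulr_suml.
  by apply: eq_bigr => j _; rewrite (tpair_ins idfun).
rewrite !E; apply: eq_bigr => j _; have [->|jp] := eqVneq j p.
  congr (_ * _); last first.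
    by apply: eq_tpair => // s /=; apply: fixed; case/andP: (valP s).
  rewrite /tpair (reindex_inj (h := fun c : {ffun 'I_(d p) -> 'I_2} => [ffun v => c (tperm q r v)])) /=.
    apply: eq_bigr => c _; move/symP: (Hu p) => -> /=; congr (_ * _).
    rewrite (reindex_inj (@perm_inj _ (tperm q r))) /=; apply: eq_bigr => v _.
    by rewrite ffunE yp tpermK.
  move=> c c' /ffunP H; apply/ffunP => v; have := H (tperm q r v).
  by rewrite !ffunE tpermK.
congr (_ * _); first by apply: eq_tpair => // v /=; apply: fixed.
rewrite !(muhat_dec Gam_dec) //; congr (_ * _).
  rewrite (reindex_inj (@perm_inj _ (tperm q r))) /=; apply: eq_bigr => v _.
  by rewrite yp tpermK.
by apply: eq_tpair => // s /=; apply: fixed; case/andP: (valP s).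
Qed.

(** From a point with equal coordinates, moving either one to t gives two points exchanged by the
    transposition, so both restrictions of [mu_poly be] are the same polynomial. *)
Lemma mderiv_mu_diag (be : Vdual R d) (q r : 'I_(d p)) (x : slot d -> R) :
  be \in hspace Gam -> x (mkslot q) = x (mkslot r) ->
  ev x (mderiv (enum_rank (mkslot r)) (mu_poly be)) =
  ev x (mderiv (enum_rank (mkslot q)) (mu_poly be)).
Proof.
move=> be_h xqr.
suff E : restr (mkslot r) x (mu_poly be) = restr (mkslot q) x (mu_poly be).
  by rewrite (ev_restr (mkslot r)) (ev_restr (mkslot q)) -!deriv_restr E xqr.
apply/eqP; rewrite -subr_eq0; apply/eqP.
apply: (@unisolvent_open R setT); [exact: openT|by exists 0|] => t _.
rewrite hornerD hornerN !horner_restr !ev_mu_poly -(mu_tperm q r _ be_h).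
apply/eqP; rewrite subr_eq0; apply/eqP; apply: eq_tpair => // v /=.
case: tpermP => [->|->|/eqP /negbTE -> /eqP /negbTE ->] //.
  by rewrite eqxx; case: eqP => // ->.
by rewrite eq_sym xqr.
Qed.

End Symmetry.

(** * The substitution x_pq = x_pr = x *)

Section Diagonal.

Variables (R : realType) (k : nat) (d : 'I_k -> nat).
Variables (p : 'I_k) (q r : 'I_(d p)).

Local Notation mp := (mpoly.mpoly #|slot d| R).
Local Notation s := (mkslot q).
Local Notation u := (mkslot r).
Local Notation iota := (@diag_iota R k d p q r).

HB.instance Definition _ := GRing.RMorphism.copy (@Rx_C R)
  (@tofrac {poly R} \o polyC : R -> ratfun R).

HB.instance Definition _ := GRing.RMorphism.copy iota
  (@tofrac _ \o @mpolyC #|rest q r| (ratfun R) : ratfun R -> diagfield R q r).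

HB.instance Definition _ := GRing.RMorphism.copy (@diag_subst R k d p q r)
  (mmap (iota \o @Rx_C R) (diag_var R q r \o enum_val)).

Lemma diag_substC c : diag_subst q r (mpolyC #|slot d| c) = iota (Rx_C c).
Proof. exact: (mpoly.mmapC (diag_var R q r \o enum_val) (iota \o @Rx_C R) c). Qed.

Lemma diag_subst_var v : diag_subst q r (var R v) = diag_var R q r v.
Proof.
transitivity (mpoly.mmap1 (diag_var R q r \o enum_val) (mnm1 (enum_rank v))).
  exact: (mpoly.mmapX (diag_var R q r \o enum_val) (iota \o @Rx_C R)).
by rewrite mpoly.mmap1U /= enum_rankK.
Qed.

Lemma diag_var_left : diag_var R q r s = iota (Rx_X R).
Proof. by rewrite /diag_var insubN // negb_and negbK eqxx. Qed.

Lemma diag_var_right : diag_var R q r u = iota (Rx_X R).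
Proof. by rewrite /diag_var insubN // negb_and !negbK eqxx orbT. Qed.

(** Places a polynomial in x in one slot variable, so that it can be evaluated on the box before it
    becomes a scalar of R(x). *)
Definition in_slot (v : slot d) (N : {poly R}) : mp :=
  (map_poly (mpolyC #|slot d| (R := R)) N).[var R v].

Lemma in_slot_step v N c :
  in_slot v (N * 'X + c%:P) = in_slot v N * var R v + mpolyC #|slot d| c.
Proof. by rewrite /in_slot rmorphD rmorphM /= map_polyX map_polyC hornerMXaddC. Qed.

Lemma in_slot0 v : in_slot v 0 = 0.
Proof. by rewrite /in_slot rmorph0 horner0. Qed.

Lemma ev_in_slot x v N : ev x (in_slot v N) = N.[x v].
Proof.
elim/poly_ind: N => [|N c IH]; first by rewrite in_slot0 rmorph0 horner0.
by rewrite in_slot_step rmorphD rmorphM /= IH ev_var evC hornerMXaddC.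
Qed.

Lemma diag_subst_in_slot N : diag_subst q r (in_slot u N) = iota (tofr R N).
Proof.
elim/poly_ind: N => [|N c IH]; first by rewrite in_slot0 !rmorph0.
rewrite in_slot_step rmorphD rmorphM /= IH diag_subst_var diag_var_right diag_substC.
by rewrite !rmorphD !rmorphM.
Qed.

(** The box of a solution has no point on the diagonal, hence [F] is tested with x_s overwritten by
    x_u. The substitution factors through [sg], and [sg F] vanishes on the box. *)
Lemma diag_subst_eq0 (I : slot d -> set R) (F : mp) :
  (forall v, unisolvent (I v)) ->
  (forall x, box I x -> ev [eta x with s |-> x u] F = 0) ->
  diag_subst q r F = 0.
Proof.
move=> uI F0.
pose h (i : 'I_#|slot d|) : mp := var R (if enum_val i == s then u else enum_val i).
pose sg : {rmorphism mp -> mp} := mmap (@mpolyC #|slot d| R) h.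
have sgC c : sg (mpolyC #|slot d| c) = mpolyC #|slot d| c by exact: mpoly.mmapC.
have sgX i : sg (mpolyX R (mnm1 i)) = h i.
  by transitivity (mpoly.mmap1 h (mnm1 i)); [exact: mpoly.mmapX|exact: mpoly.mmap1U].
have ev_sg x G : ev x (sg G) = ev [eta x with s |-> x u] G.
  elim/mpoly_ring_ind: G => [c|i|f g Hf Hg|f g Hf Hg].
  - by rewrite sgC !evC.
  - by rewrite sgX ev_var /ev mpoly.mevalXU /=; case: ifP.
  - by rewrite !rmorphD /= Hf Hg.
  - by rewrite !rmorphM /= Hf Hg.
have <- : diag_subst q r (sg F) = diag_subst q r F.
  elim/mpoly_ring_ind: F {F0} => [c|i|f g Hf Hg|f g Hf Hg].
  - by rewrite sgC.
  - rewrite sgX diag_subst_var -[i in RHS]enum_valK diag_subst_var.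
    by case: ifP => // /eqP ->; rewrite diag_var_left diag_var_right.
  - by rewrite !rmorphD /= Hf Hg.
  - by rewrite !rmorphM /= Hf Hg.
have -> : sg F = 0 by apply: (ev_box_eq0 uI) => x bx; rewrite ev_sg F0.
by rewrite rmorph0.
Qed.

End Diagonal.

(** * [star] as a quadratic form in [b] and [b'] with coefficients in R(x) *)

Lemma star_coefE (K0 K : fieldType) (j : {rmorphism K0 -> K})
    (a a1 a2 S S1 : K0) (b b' : K) (n1 n2 : nat) :
  j a * ((j S ^+ 2 + j S1) * b ^+ 2 - 2 * n1%:R * b * b' * j S + n1%:R * n2%:R * b' ^+ 2) +
  2 * j a1 * (j S * b ^+ 2 - n1%:R * b * b') + j a2 * b ^+ 2 =
  j (a2 + 2 * a1 * S + a * (S ^+ 2 + S1)) * b ^+ 2 +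
  j (- (2 * n1%:R * (a1 + a * S))) * (b * b') + j (n1%:R * n2%:R * a) * b' ^+ 2.
Proof. rewrite !(rmorphB, rmorphN, rmorphM, rmorphXn, rmorph_nat, rmorphD) /=; ring. Qed.

Lemma Rx_C_eq0 (R : realType) (c : R) : Rx_C c = 0 -> c = 0.
Proof. by move/eqP; rewrite /Rx_C tofrac_eq0 polyC_eq0 => /eqP. Qed.

Lemma natr_ratfun_neq0 (R : realType) n : (n.+1%:R : ratfun R) != 0.
Proof.
rewrite -(rmorph_nat (@tofr R)) tofrac_eq0 -polyC_natr polyC_eq0.
by rewrite pnatr_eq0.
Qed.

Section StarNumerators.

Variables (A : comNzRingType) (K0 : fieldType) (F : {rmorphism A -> K0}).
Variables (f0 f1 f2 g h0 h1 h2 g' L L1 L2 : A) (n1 n2 : nat).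

(** For A = f0/g - h0/g', with derivatives f1/g - h1/g' and f2/g - h2/g', and S = L1/L, these are
    the numerators over [L * g * g'] of the coefficients of b^2, b b', b'^2 in [star]. *)
Definition star_num0 : A :=
  g' * (f2 * L + 2 * f1 * L1 + f0 * L2) - g * (h2 * L + 2 * h1 * L1 + h0 * L2).
Definition star_num1 : A :=
  - (2 * n1%:R * (g' * (f1 * L + f0 * L1) - g * (h1 * L + h0 * L1))).
Definition star_num2 : A := n1%:R * n2%:R * L * (g' * f0 - g * h0).

Lemma star_numE : F L != 0 -> F g != 0 -> F g' != 0 ->
  let a0 := F f0 / F g - F h0 / F g' in
  let a1 := F f1 / F g - F h1 / F g' in
  let a2 := F f2 / F g - F h2 / F g' in
  let S := F L1 / F L in let S1 := F (L2 * L - L1 * L1) / F (L ^+ 2) in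
  [/\ a2 + 2 * a1 * S + a0 * (S ^+ 2 + S1) = F star_num0 / F (L * g * g'),
      - (2 * n1%:R * (a1 + a0 * S)) = F star_num1 / F (L * g * g') &
      n1%:R * n2%:R * a0 = F star_num2 / F (L * g * g')].
Proof.
move=> l0 g0 g0'; rewrite /star_num0 /star_num1 /star_num2 /=.
rewrite !(rmorphB, rmorphN, rmorphM, rmorphXn, rmorph_nat, rmorphD) /=.
by split; field; rewrite l0 g0 g0'.
Qed.

End StarNumerators.

Lemma log_deriv_step (K : fieldType) (n : nat) (l l' P P' S : K) : l != 0 -> S * P = P' ->
  (n%:R * (l' / l) + S) * (l ^+ n * P) = l' * l ^+ n.-1 *+ n * P + l ^+ n * P'.
Proof.
move=> l0 <-; case: n => [|n]; first by rewrite mulr0n !mul0r !add0r expr0 !mul1r.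
by rewrite -pred_Sn -mulr_natl exprS; field.
Qed.

Lemma deriv0_const (R : realType) (f : {poly R}) : f^`() = 0 -> f = (f`_0)%:P.
Proof.
move=> f0; apply/polyP => -[|i]; rewrite coefC //=.
move/(congr1 (coefp i)): f0; rewrite /= coef_deriv coef0 => /eqP.
by rewrite mulrn_eq0 => /eqP.
Qed.

(** * Rationality of the solutions in the p-slots *)

Section RationalSolutions.

Variables (R : realType) (k : nat) (d : 'I_k -> nat).
Variable Gam : forall j, tensor R (slots d (off predT j)).
Variables (be : Vdual R d) (p : 'I_k) (e : 'I_k -> 'rV[R]_2).
Hypothesis be_h : be \in hspace Gam.
Variable Gamt : forall j, tensor R (slots d (off (off predT j) p)).
Hypothesis Gam_dec : forall (j : 'I_k) (pj : p != j),
  Gam j = @ins R k d (off predT j) p pj (Gamt j) (tpow (d p) (e j)).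
Variables (I : slot d -> set R) (A : slot d -> R -> R).
Hypothesis A_sol : extremality_solution Gam be I A.

Local Notation mp := (mpoly.mpoly #|slot d| R).
Local Notation n1 := (slots_dim d + 1)%N.
Local Notation n2 := (slots_dim d + 2)%N.
Local Notation "''d_' s" := (mderiv (enum_rank s)) (at level 0, s at level 2).
Local Notation W := (weight_poly Gam).
Local Notation B := (mu_poly be).
Local Notation L := (lin_weight d p e).

Lemma box_nonempty : exists x, box I x.
Proof.
have [HI _ _ _] := A_sol.
have /choice[x Hx] : forall s, exists t, I s t by move=> s; have [_ _] := HI s.
by exists x.
Qed.

Lemma unisolvent_I s : unisolvent (I s).
Proof. by have [/(_ s)[oI _ In] _ _ _] := A_sol; exact: unisolvent_open. Qed.

Lemma ev_lin_weight_neq0 (x : slot d -> R) (r : 'I_(d p)) :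
  box I x -> L.[x (mkslot r)] != 0.
Proof.
by move=> bx; apply: (lin_weight_neq0 Gam_dec) => j; exact: (box_muhat_neq0 A_sol j bx).
Qed.

Lemma box_weight_neq0 x : box I x -> ev x W != 0.
Proof.
move=> bx; rewrite ev_weight_poly; apply/prodf_neq0 => j _.
by rewrite expf_neq0 // (box_muhat_neq0 A_sol j bx).
Qed.

Lemma lin_weight_poly_neq0 : (0 < d p)%N -> L != 0.
Proof.
move=> dp; have [x bx] := box_nonempty.
apply/eqP => L0; have := ev_lin_weight_neq0 (Ordinal dp) bx.
by rewrite L0 horner0 eqxx.
Qed.

Lemma Ssum_log_deriv : (0 < d p)%N -> Ssum d p e = tofr R L^`() / tofr R L.
Proof.
move=> dp; have L0 : tofr R L != 0 by rewrite tofrac_eq0 lin_weight_poly_neq0.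
apply: (canRL (mulfK L0)); move: L0.
have : forall j, j != p -> tofr R (lin e j) != 0.
  move=> j jp; have [x bx] := box_nonempty; rewrite tofrac_eq0.
  have := muhat_lin_neq0 Gam_dec (Ordinal dp) jp (box_muhat_neq0 A_sol j bx).
  by apply: contra_neq => ->; rewrite horner0.
rewrite /Ssum /lin_weight => l0 _.
(* The invariant S P = P' for partial products involves no division by [P]; each factor adds d_j l'
   / l to S. *)
apply: (big_rec2 (fun S P => S * tofr R P = tofr R P^`())).
  by rewrite derivC mul0r rmorph0.
move=> j S P jp IH.
have -> : Rx_C (e j ord0 0) + Rx_X R * Rx_C (e j ord0 1) = tofr R (lin e j).
  by rewrite rmorphD rmorphM.
have -> : Rx_C (e j ord0 1) = tofr R (lin e j)^`().
  by rewrite /lin derivD derivM derivX !derivC mulr0 addr0 add0r mul1r.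
move: (lin e j) (l0 j jp) => l lj.
rewrite derivM deriv_exp rmorphD !rmorphM rmorphMn !rmorphM !rmorphXn /=.
exact: (log_deriv_step (d j) _ lj IH).
Qed.

(** Independence is asked over R and on the box, the form in which [rational_span3] uses it through
    sample points [x]. *)
Lemma rational_solution (q r : 'I_(d p)) : q != r ->
  (forall c0 c1 c2 : R,
     (forall x, box I x ->
        let v := ev x ('d_(mkslot q) B) in let w := ev x B - x (mkslot q) * v in
        c0 * w ^+ 2 + c1 * (w * v) + c2 * v ^+ 2 = 0) ->
     [/\ c0 = 0, c1 = 0 & c2 = 0]) ->
  rational_on (I (mkslot q)) (A (mkslot q)).
Proof.
move=> qr indep; set s := mkslot q; pose J := I s.
pose a0 := A s; pose a1 := derive1 a0; pose a2 := derive1n 2 a0.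
pose K0 t := red0 (a0 t) (a1 t) (a2 t) L.[t] L^`().[t] L^`()^`().[t].
pose K1 t := red1 d (a0 t) (a1 t) L.[t] L^`().[t].
pose K2 t := red2 d (a0 t) L.[t].
(* The coefficients of w^2, w v, v^2 in K0 b^2 + K1 b v + K2 v^2 for b = w + t v. *)
have [w0r w1r w2r] : [/\ rational_on J K0, rational_on J (fun t => 2 * t * K0 t + K1 t) &
    rational_on J (fun t => t ^+ 2 * K0 t + t * K1 t + K2 t)].
  apply: (rational_span3 (S := fun b0 b1 b2 => exists2 x, box I x &
    let v := ev x ('d_s B) in let w := ev x B - x s * v in
    [/\ b0 = w ^+ 2, b1 = w * v & b2 = v ^+ 2])); last first.
    move=> c0 c1 c2 Hc; apply: indep => x bx v w.
    by apply: Hc; exists x.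
  move=> _ _ _ [x bx [-> -> ->]].
  have [H [HJ Hs _]] := term_continuation Gam_dec A_sol qr bx.
  have HJ' : rational_on J H by case: HJ => n [m Hm]; exists n, m => t Jt; apply: Hm; left.
  have Wt t : J t -> ev [eta x with s |-> t] W != 0.
    by move=> Jt; exact: box_weight_neq0 (box_update bx Jt).
  apply: (@eq_rational_on _ _ (fun t => H t * L.[t] * (ev [eta x with s |-> t] W)^-1)).
    move=> t Jt; rewrite -Hs // /sol_term.
    have := term_grouped be Gam_dec q (a0 t) (a1 t) (a2 t) [eta x with s |-> t].
    rewrite -/s /= eqxx => ->.
    have [B0 [BE [d2 d0]]] := mu_poly_affine be s.
    (* Neither [w] nor [v] involves x_s: a polynomial with zero derivative along [s] is constant
       along it. *)
    have cst (C : mp) : 'd_s C = 0 -> ev [eta x with s |-> t] C = ev x C.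
      move=> dC; rewrite -horner_restr (ev_restr s).
      have := congr1 (restr s x) dC; rewrite -deriv_restr rmorph0 => /deriv0_const ->.
      by rewrite !hornerC.
    have Bt : ev [eta x with s |-> t] B = ev x B0 + t * ev x ('d_s B).
      by rewrite {1}BE rmorphD rmorphM /= (cst B0 d0) (cst _ d2) ev_var /= eqxx.
    have Bx : ev x B = ev x B0 + x s * ev x ('d_s B).
      by rewrite {1}BE rmorphD rmorphM /= ev_var.
    rewrite Bt Bx (cst _ d2) /K2 /K1 /K0; field.
    exact: Wt.
  apply: rational_onM.
    by apply: rational_onM => //; exact: rational_on_poly.
  by apply: rational_onV => //; exact: rational_on_ev.
(* [K2] is the third coefficient minus t times the second plus t^2 times the first. *)
have K2r : rational_on J K2.
  apply: (@eq_rational_on _ _ (fun t => (t ^+ 2 * K0 t + t * K1 t + K2 t) +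
    ((- 'X).[t] * (2 * t * K0 t + K1 t) + ('X^2).[t] * K0 t))).
    by move=> t _; rewrite hornerN hornerX hornerXn; ring.
  apply: rational_onD => //; apply: rational_onD; apply: rational_onM => //; exact: rational_on_poly.
have n0 : n1%:R * n2%:R != 0 :> R by rewrite mulf_neq0 // !addnS pnatr_eq0.
have Ls t : J t -> L.[t] != 0.
  move=> Jt; have [x bx] := box_nonempty.
  have := ev_lin_weight_neq0 q (box_update bx Jt).
  by rewrite /= eqxx.
apply: (@eq_rational_on _ _ (fun t => K2 t * ((n1%:R * n2%:R) * L.[t])^-1)).
  move=> t Jt; rewrite /K2 /red2.
  have -> : n1%:R * n2%:R * a0 t * L.[t] = a0 t * (n1%:R * n2%:R * L.[t]) by ring.
  by rewrite mulfK // mulf_neq0 // Ls.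
apply: rational_onM => //; apply: rational_onV => [|t Jt].
  by apply: rational_onM; [exact: rational_on_cst|exact: rational_on_poly].
by rewrite mulf_neq0 // Ls.
Qed.

End RationalSolutions.

Lemma common_denominator_eq0 (K0 K : fieldType) (j : {rmorphism K0 -> K})
    (a0 a1 a2 m : K0) (b0 b1 b2 : K) :
  j a0 * b0 + j a1 * b1 + j a2 * b2 = 0 ->
  j (a0 / m) * b0 + j (a1 / m) * b1 + j (a2 / m) * b2 = 0.
Proof.
by move=> E; rewrite !fmorph_div ![_ / _ * _]mulrAC -!mulrDl E mul0r.
Qed.

(** * [star] for solutions, and its consequences under independence *)

Section StarOnSolutions.

Variables (R : realType) (k : nat) (d : 'I_k -> nat).
Variable Gam : forall j, tensor R (slots d (off predT j)).
Variables (be : Vdual R d) (p : 'I_k) (e : 'I_k -> 'rV[R]_2).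
Hypothesis be_h : be \in hspace Gam.
Variable Gamt : forall j, tensor R (slots d (off (off predT j) p)).
Hypothesis Gam_dec : forall (j : 'I_k) (pj : p != j),
  Gam j = @ins R k d (off predT j) p pj (Gamt j) (tpow (d p) (e j)).
Variables (I : slot d -> set R) (A : slot d -> R -> R).
Hypothesis A_sol : extremality_solution Gam be I A.

Local Notation mp := (mpoly.mpoly #|slot d| R).
Local Notation n1 := (slots_dim d + 1)%N.
Local Notation n2 := (slots_dim d + 2)%N.
Local Notation "''d_' s" := (mderiv (enum_rank s)) (at level 0, s at level 2).
Local Notation W := (weight_poly Gam).
Local Notation B := (mu_poly be).
Local Notation L := (lin_weight d p e).

Variables q r : 'I_(d p).
Hypothesis qr : q != r.
Local Notation s := (mkslot q).
Local Notation u := (mkslot r).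
Local Notation iota := (@diag_iota R k d p q r).

(** The relation extends from the box to polynomials and becomes, on the diagonal, a relation
    between b^2, b b', b'^2 over R(x). The slot [v] is general so as to cover both (p,q) and
    (p,r). *)
Lemma diag_indep_box (v : slot d) (c0 c1 c2 : R) :
  diag_var R q r v = iota (Rx_X R) -> diag_subst q r ('d_v B) = mu_diag' q r be ->
  diag_independent q r be ->
  (forall x, box I x ->
     let w' := ev x ('d_v B) in let w := ev x B - x v * w' in
     c0 * w ^+ 2 + c1 * (w * w') + c2 * w' ^+ 2 = 0) ->
  [/\ c0 = 0, c1 = 0 & c2 = 0].
Proof.
move=> dv dB ind E.
pose C (c : R) : mp := mpolyC #|slot d| c.
have F0 : C c0 * (B - var R v * 'd_v B) ^+ 2 + C c1 * ((B - var R v * 'd_v B) * 'd_v B)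
    + C c2 * 'd_v B ^+ 2 = 0.
  apply: (ev_box_eq0 (unisolvent_I A_sol)) => x bx.
  by rewrite !(rmorphB, rmorphM, rmorphXn, rmorphD) /= !evC ev_var; exact: E.
move/(congr1 (diag_subst q r)): F0.
rewrite rmorph0 !(rmorphB, rmorphM, rmorphXn, rmorphD) /= !diag_substC diag_subst_var dv dB.
rewrite -/(mu_diag q r be) => F0.
(* The coefficients after expanding w = b - x b'. *)
have [] := ind (Rx_C c0) (Rx_C c1 - 2 * Rx_C c0 * Rx_X R)
    (Rx_C c2 - Rx_C c1 * Rx_X R + Rx_C c0 * Rx_X R ^+ 2).
  rewrite -[RHS]F0 !(rmorphB, rmorphM, rmorphXn, rmorph_nat, rmorphD) /=; ring.
move=> /Rx_C_eq0 ->; rewrite rmorph0 mulr0 !mul0r subr0 addr0 => /Rx_C_eq0 ->.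
by rewrite rmorph0 mul0r subr0 => /Rx_C_eq0 ->.
Qed.

Lemma diag_subst_mderiv_right : diag_subst q r ('d_u B) = mu_diag' q r be.
Proof.
apply/eqP; rewrite -subr_eq0 -rmorphB; apply/eqP.
apply: (diag_subst_eq0 (unisolvent_I A_sol)) => x bx.
rewrite rmorphB /= (mderiv_mu_diag (q := q) Gam_dec be_h) ?subrr //= eqxx.
by case: ifP.
Qed.

Section StarReal.

Variables (g f0 f1 f2 g' h0 h1 h2 : {poly R}).
Hypothesis Hs : forall t, I s t -> [/\ g.[t] != 0, A s t = f0.[t] / g.[t],
          derive1 (A s) t = f1.[t] / g.[t] & derive1n 2 (A s) t = f2.[t] / g.[t]].
Hypothesis Hu : forall t, I u t -> [/\ g'.[t] != 0, A u t = h0.[t] / g'.[t],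
          derive1 (A u) t = h1.[t] / g'.[t] & derive1n 2 (A u) t = h2.[t] / g'.[t]].

(** The factor [g.[t]] is present because [g] is known to be non-zero on [I s], while [t] lies in
    [I u]. Where [g.[t]] is non-zero, the fractions over [g] extend to [t]. *)
Lemma star_num_diag (x : slot d -> R) : box I x ->
  let t := x u in let z := [eta x with s |-> t] in
  let b := ev z B in let b' := ev z ('d_s B) in
  g.[t] * ((star_num0 f0 f1 f2 g h0 h1 h2 g' L L^`() L^`()^`()).[t] * b ^+ 2 +
    (star_num1 f0 f1 g h0 h1 g' L L^`() n1).[t] * (b * b') +
    (star_num2 f0 g h0 g' L n1 n2).[t] * b' ^+ 2) = 0.
Proof.
move=> bx t z b b'; have [->|gt0] := eqVneq g.[t] 0; first by rewrite mul0r.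
have us : (u == s) = false by rewrite (inj_eq (@mkslot_inj _ _ _)) eq_sym (negbTE qr).
have zs : z s = t by rewrite /= eqxx.
have zu : z u = t by rewrite /= us.
have It : I u t by exact: bx.
have [gt0' A0 A1 A2] := Hu It.
have [H [HJ H1 H2]] := term_continuation Gam_dec A_sol qr bx.
(* Continuation in x_s from [I s], where both functions equal the summand of [s], to [t]. *)
have TT : term Gam be s (f0.[t] / g.[t]) (f1.[t] / g.[t]) (f2.[t] / g.[t]) z =
    term Gam be u (h0.[t] / g'.[t]) (h1.[t] / g'.[t]) (h2.[t] / g'.[t]) z.
  transitivity (H t); last by rewrite H2 -A0 -A1 -A2 /sol_term -/z zu.
  apply: (rational_on_continuation (unisolvent_I A_sol (s := s))
    (f := fun t => term Gam be s (f0.[t] / g.[t]) (f1.[t] / g.[t]) (f2.[t] / g.[t])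
      [eta x with s |-> t])) HJ _.
    have J0 v : (I s `|` [set t])%classic v -> g.[v] != 0.
      by move=> [/Hs[]|->].
    have Jq f : rational_on (I s `|` [set t]) (fun v => f.[v] / g.[v]).
      apply: rational_onM; first exact: rational_on_poly.
      by apply: rational_onV => //; exact: rational_on_poly.
    apply: rational_onD; first apply: rational_onD.
    - by apply: rational_onM => //; exact: rational_on_ev.
    - apply: rational_onM; last exact: rational_on_ev.
      by apply: rational_onM => //; exact: rational_on_cst.
    - by apply: rational_onM => //; exact: rational_on_ev.
  move=> v Iv; have xv : [eta x with s |-> v] s = v by rewrite /= eqxx.
  have [_ e0 e1 e2] := Hs Iv; rewrite -e0 -e1 -e2 -(H1 v Iv).
  rewrite /sol_term xv; exact: erefl.
have Lt : L.[t] != 0 by exact: (ev_lin_weight_neq0 Gam_dec A_sol r bx).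
have Wz : ev z W != 0.
  have := weight_update Gam_dec x q t; rewrite -/z; apply: contra_eq_neq => ->.
  by rewrite mul0r eq_sym; apply: mulf_neq0; [exact: (box_weight_neq0 A_sol bx)|exact: Lt].
have Es := term_grouped be Gam_dec q (f0.[t] / g.[t]) (f1.[t] / g.[t]) (f2.[t] / g.[t]) z.
have Eu := term_grouped be Gam_dec r (h0.[t] / g'.[t]) (h1.[t] / g'.[t]) (h2.[t] / g'.[t]) z.
rewrite /= eqxx -/b -/b' TT in Es.
(* By symmetry the derivative along [u] is the same [b'], and both slots have value [t], so [W] and
   [L] agree in the two forms. *)
rewrite /= us -/t (mderiv_mu_diag (q := q) Gam_dec be_h (etrans zs (esym zu))) -/b -/b' Es in Eu.
move/(mulfI Wz): Eu; rewrite /red0 /red1 /red2 /star_num0 /star_num1 /star_num2.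
move/eqP; rewrite -subr_eq0 => /eqP E.
(* One factor [g * g'] clears the fractions; the other [g] is the one of the statement. *)
rewrite -[RHS](mulr0 (g.[t] ^+ 2 * g'.[t])) -[in RHS]E -!polyC_natr.
rewrite !(hornerM, hornerD, hornerN, hornerC); field.
by rewrite gt0 gt0'.
Qed.

End StarReal.

Lemma star_solution (aq ar : ratfun R) :
  restricts aq (I s) (A s) -> restricts ar (I u) (A u) -> star q r e be (aq - ar).
Proof.
have [HI _ _ _] := A_sol.
have [oIs _ Is] := HI s; have [oIu _ Iu] := HI u.
move=> /(restricts_common_denominator oIs Is)[g [f0 [f1 [f2 [g0 E0 E1 E2 Hs]]]]].
move=> /(restricts_common_denominator oIu Iu)[g' [h0 [h1 [h2 [g0' E0' E1' E2' Hu]]]]].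
have dp : (0 < d p)%N by exact: leq_ltn_trans (ltn_ord q).
have nz (f : {poly R}) : f != 0 -> tofr R f != 0 by rewrite tofrac_eq0.
have L0 := lin_weight_poly_neq0 Gam_dec A_sol dp.
pose N0 := star_num0 f0 f1 f2 g h0 h1 h2 g' L L^`() L^`()^`().
pose N1 := star_num1 f0 f1 g h0 h1 g' L L^`() n1.
pose N2 := star_num2 f0 g h0 g' L n1 n2.
(* The coefficients are put in slot [u], whose interval contains the sample values of x. The factor
   [g] cancels afterwards, being non-zero in the field. *)
have : diag_subst q r (in_slot u g * (in_slot u N0 * B ^+ 2 + in_slot u N1 * (B * 'd_s B)
    + in_slot u N2 * 'd_s B ^+ 2)) = 0.
  apply: (diag_subst_eq0 (unisolvent_I A_sol)) => x bx.
  rewrite !(rmorphM, rmorphXn, rmorphD) /= !ev_in_slot.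
  have -> : [eta x with s |-> x u] u = x u by move=> /=; case: ifP.
  exact: (star_num_diag Hs Hu bx).
rewrite !(rmorphM, rmorphXn, rmorphD) /= !diag_subst_in_slot => /eqP.
rewrite mulf_eq0 fmorph_eq0 (negbTE (nz _ g0)) /= => /eqP F0.
have [e0 e1 e2] := star_numE f0 f1 f2 h0 h1 h2 L^`() L^`()^`() n1 n2
  (nz _ L0) (nz _ g0) (nz _ g0').
rewrite /star (Ssum_log_deriv Gam_dec A_sol dp) !Rx_derivB E2 E2' E1 E1' E0 E0'.
rewrite (Rx_derivE _ L0).
refine (etrans (star_coefE iota _ _ _ _ _ _ _ n1 n2) _).
rewrite e0 e1 e2; exact: common_denominator_eq0 F0.
Qed.

Lemma star_independent (C : ratfun R) :
  diag_independent q r be -> star q r e be C -> C = 0.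
Proof.
move=> ind starC.
have E := etrans (esym (star_coefE iota C (Rx_deriv C) (Rx_deriv (Rx_deriv C)) (Ssum d p e)
  (Rx_deriv (Ssum d p e)) (mu_diag q r be) (mu_diag' q r be) n1 n2)) starC.
(* The third coefficient is (m+1)(m+2) C, with m+1 and m+2 non-zero in characteristic 0. *)
have [_ _ /eqP] := ind _ _ _ E.
by rewrite mulf_eq0 mulf_eq0 !addnS !(negbTE (natr_ratfun_neq0 _ _)) => /eqP.
Qed.

End StarOnSolutions.

(** The rational functions [aq] and [ar] are any that restrict to the solution; the last part
    provides them under independence, so that their equality is not vacuous. *)
Theorem proposition3p3p2 (R : realType) (k : nat) (d : 'I_k -> nat)
    (d_ge1 : forall j, (1 <= d j)%N)
    (m_ge2 : (2 <= slots_dim d)%N)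
    (Gam : forall j, tensor R (slots d (off predT j)))
    (Gam_neq0 : forall j, Gam j != 0)
    (Gam_k1 : k = 1%N -> forall j, Gam j = [ffun=> 1])
    (dim_h : (\dim (hspace Gam) = (slots_dim d).+1)%N)
    (be : Vdual R d) (be_h : be \in hspace Gam) (be_neq0 : be != 0)
    (p : 'I_k) (dp_ge2 : (2 <= d p)%N) (q r : 'I_(d p)) (qr : q != r)
    (e : 'I_k -> 'rV[R]_2)
    (Gamt : forall j, tensor R (slots d (off (off predT j) p)))
    (Gam_dec : forall (j : 'I_k) (pj : p != j),
       Gam j = @ins R k d (off predT j) p pj (Gamt j) (tpow (d p) (e j)))
    (I : slot d -> set R) (A : slot d -> R -> R)
    (A_sol : extremality_solution Gam be I A) :
  (forall aq ar : ratfun R,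
     restricts aq (I (mkslot q)) (A (mkslot q)) ->
     restricts ar (I (mkslot r)) (A (mkslot r)) ->
     star q r e be (aq - ar) /\
     (diag_independent q r be ->
        (forall B : ratfun R, star q r e be B -> B = 0) /\ aq = ar)) /\
  (diag_independent q r be ->
     exists aq ar : ratfun R,
       restricts aq (I (mkslot q)) (A (mkslot q)) /\
       restricts ar (I (mkslot r)) (A (mkslot r))).
Proof.
split=> [aq ar Hq Hr|ind].
  have Hs := star_solution be_h Gam_dec A_sol qr Hq Hr.
  split=> // ind; split=> [B|]; first exact: star_independent.
  by apply/eqP; rewrite -subr_eq0; apply/eqP; exact: star_independent ind Hs.
have [aq Hq] : exists aq, restricts aq (I (mkslot q)) (A (mkslot q)).
  apply/rational_on_restricts/(rational_solution Gam_dec A_sol qr) => c0 c1 c2.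
  apply: (diag_indep_box A_sol) ind; [exact: diag_var_left|by []].
have [ar Hr] : exists ar, restricts ar (I (mkslot r)) (A (mkslot r)).
  (* The same argument with [q] and [r] exchanged; the symmetry of [be] identifies the derivative
     along (p,r) with [mu_diag'] on the diagonal. *)
  rewrite eq_sym in qr.
  apply/rational_on_restricts/(rational_solution Gam_dec A_sol qr) => c0 c1 c2.
  apply: (diag_indep_box A_sol) ind; first exact: diag_var_right.
  exact: (diag_subst_mderiv_right be_h Gam_dec A_sol q r).
by exists aq, ar.
Qed.
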